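(* Let $f\in\mathcal{U}$ be of the form $f(z)=z+a_2z^2+a_3z^3+\cdots$. Then (i) $|a_2^2-a_3|\le 1$; (ii) $|a_3^2-a_5|\le 4$. These inequalities are sharp in the class $\mathcal{U}$, with equality in both (i) and (ii) for the Koebe function $k(z)=\frac{z}{(1-z)^2}=z+\sum_{n=2}^{\infty}nz^n$ and its rotations $e^{-i\theta}k(e^{i\theta}z)$, $\theta\in\mathbb{R}$.
   Context: Let $\mathbb{D}=\{z\in\mathbb{C}:|z|<1\}$ be the open unit disk, and let $\mathcal{A}$ be the class of functions $f$ analytic in $\mathbb{D}$ of the form $f(z)=z+a_2z^2+a_3z^3+\cdots$ (so $a_n$ denotes the $n$-th Taylor coefficient of $f$ at $0$, with $f(0)=0$, $f'(0)=1$). The class $\mathcal{U}$ is $$\mathcal{U}=\left\{f\in\mathcal{A}:\left|\left(\frac{z}{f(z)}\right)^2f'(z)-1\right|<1 \text{ for all } z\in\mathbb{D}\right\}.$$ Here $z/f(z)$ is understood to take the value $1$ at $z=0$ (removable singularity), and the condition includes that the expression is defined, i.e. $f(z)\neq 0$ for $z\in\mathbb{D}\setminus\{0\}$. *)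

(* Defs.v *)
From Stdlib Require Import Reals Factorial.
From Coquelicot Require Import Coquelicot.

Open Scope C_scope.

(* [C] carries two normed-module structures in Coquelicot, over [R] and over
   [C]; the complex one is always given explicitly below. *)
Definition c_is_pseries (a : nat -> C) (z l : C) : Prop :=
  @is_pseries C_AbsRing C_NormedModule a z l.

(* Analytic: the sum of a convergent power series near each point of the disk.
   Functions on the disk are total functions on [C]; every notion below depends
   only on their values inside the (open) disk. *)
Definition analytic_on_disk (f : C -> C) : Prop :=
  forall z0 : C, (Cmod z0 < 1)%R ->
  exists (b : nat -> C) (r : R), (0 < r)%R /\
    forall z : C, (Cmod (z - z0) < r)%R -> c_is_pseries b (z - z0) (f z).

(* [C_derive] is a total function: it is the complex derivative wherever [f] is
   complex differentiable, in particular where [f] is analytic. *)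
Definition taylor_coeff (f : C -> C) (n : nat) : C :=
  Nat.iter n C_derive f 0 / RtoC (INR (fact n)).

Definition class_A (f : C -> C) : Prop :=
  analytic_on_disk f /\ taylor_coeff f 0 = 0 /\ taylor_coeff f 1 = 1.

(* z / f(z), with its removable singularity at 0 filled in. *)
Definition z_over (f : C -> C) (z : C) : C :=
  if Ceq_dec z 0 then 1 else z / f z.

(* Division by 0 is total in [C], so the nonvanishing of [f] is required
   explicitly. *)
Definition class_U (f : C -> C) : Prop :=
  class_A f /\
  (forall z : C, (Cmod z < 1)%R -> z <> 0 -> f z <> 0) /\
  (forall z : C, (Cmod z < 1)%R ->
     (Cmod (z_over f z ^ 2 * C_derive f z - 1) < 1)%R).

Definition koebe (z : C) : C := z / (1 - z) ^ 2.

Definition cis (theta : R) : C := (cos theta, sin theta).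

Definition rotation (f : C -> C) (theta : R) (z : C) : C :=
  cis (- theta) * f (cis theta * z).

(* Main.v *)
Require Import Defs.
From Stdlib Require Import Reals Factorial Lra Lia Classical ClassicalEpsilon.
From Coquelicot Require Import Coquelicot.
Open Scope C_scope.

(** Set omega = 1/z^2 - f'/f^2, the derivative of q = 1/f - 1/z. Membership in
    the class says that |z^2 omega(z)| < 1. The singularity of omega at 0 is
    removable, with expansion c0 + c1 z + c2 z^2 + O(z^3) where
    c0 = a2^2 - a3, so the Schwarz lemma gives |omega| <= 1 on the disk
    [omega_le_1]; inequality (i) is |c0| <= 1.

    For (ii), write a3^2 - a5 = a2^2 c0 + a2 c1 + c2/3. With x = |c0|, the
    Schwarz-Pick inequality gives |c1|, |c2| <= 1 - x^2. These bounds and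
    |a2| <= 2 alone are too weak when x is slightly below 1; one also needs |a2|
    to be smaller when x is smaller, namely |a2| <= 2 - (1 - x)/4
    [class_U_second_coeff]. This comes from the nonvanishing of
    z/f(z) = 1 + z q(z), where q(0) = -a2. Schwarz-Pick bounds the growth of
    omega = q', hence |q - q(0)| <= 1 - (1 - x)/4; were |a2| larger than
    claimed, z -> -1/q(z) would be a contraction of a smaller closed disk, and
    its fixed point would be a zero of 1 + z q(z) [omitted_value_bound]. What
    remains is a polynomial inequality in x on [0, 1].

    The complex analysis needs no integration. Every function involved has, at
    each point of the punctured disk, an expansion A + B h + D h^2 + O(h^3)
    (a [jet]), a property stable under algebraic operations. Averaging over h,
    -h, ih, -ih cancels the terms in h and h^2, so the average of phi(z + h) is
    phi(z) + O(h^3), while the average of |z + h|^2 exceeds |z|^2 by |h|^2;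
    hence |phi|^2 + eps |z|^2 has no interior maximum [no_interior_max]. The
    isolated singularity at 0 is removed by applying this to z phi^n and letting
    n grow [punctured_max_principle].

    The link between Taylor coefficients, defined by iterated complex
    derivatives, and power series is term-by-term differentiation
    [pseries_derivative]. Sharpness is a computation with the Koebe function,
    for which (z/k)^2 k' - 1 = -z^2, and with the effect of a rotation on
    coefficients. *)

(** * Power series and complex derivatives *)

Lemma pow_n_Cpow (z : C) (n : nat) : @pow_n C_AbsRing z n = z ^ n.
Proof.
induction n as [|n IH]; simpl; [reflexivity|].
now rewrite IH.
Qed.

Definition partial_sum (b : nat -> C) (z : C) (n : nat) : C :=
  @sum_n C_AbsRing (fun k => b k * z ^ k) n.

Lemma partial_sum_0 b z : partial_sum b z 0 = b 0%nat.
Proof. unfold partial_sum; rewrite sum_O; simpl; ring. Qed.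

Lemma partial_sum_S b z n :
  partial_sum b z (S n) = partial_sum b z n + b (S n) * z ^ (S n).
Proof. unfold partial_sum; now rewrite sum_Sn. Qed.

Lemma pseries_partial_sum b z n :
  @sum_n C_NormedModule (fun k => scal (@pow_n C_AbsRing z k) (b k)) n = partial_sum b z n.
Proof.
apply sum_n_ext; intros k.
rewrite pow_n_Cpow.
change (z ^ k * b k = b k * z ^ k); ring.
Qed.

Lemma c_is_pseries_eps b z l :
  c_is_pseries b z l <->
  forall eps, (0 < eps)%R -> exists N, forall n, (N <= n)%nat ->
    (Cmod (partial_sum b z n - l) < eps)%R.
Proof.
unfold c_is_pseries, is_pseries, is_series; split.
- intros H eps He.
  assert (L := @locally_ball_norm C_AbsRing C_NormedModule l (mkposreal eps He)).
  destruct (H _ L) as [N HN].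
  exists N; intros n Hn; specialize (HN n Hn).
  rewrite pseries_partial_sum in HN.
  exact HN.
- intros H P HP.
  destruct (@locally_norm_le_locally _ C_NormedModule l P HP) as [eps He].
  destruct (H eps (cond_pos eps)) as [N HN].
  exists N; intros n Hn.
  apply He; rewrite pseries_partial_sum.
  exact (HN n Hn).
Qed.

(** The form in which every derivative below is computed: an error bounded by
    |h|^2 is what both power series and second-order expansions provide. *)
Lemma C_derive_of_quadratic_error (f : C -> C) (z l : C) :
  (exists d K : R, (0 < d)%R /\ forall h : C, h <> 0 -> (Cmod h < d)%R ->
     (Cmod (f (z + h) - f z - l * h)%C <= K * Cmod h ^ 2)%R) ->
  C_derive f z = l.
Proof.
intros (d & K & Hd & H).
apply is_C_derive_unique.
split; [apply is_linear_scal_l|].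
intros x Hx eps.
assert (E : z = x) by exact (is_filter_lim_locally_unique _ _ Hx).
subst x.
assert (Hp : (0 < Rmin d (eps / (Rabs K + 1)))%R).
{ apply Rmin_pos; [exact Hd|apply Rdiv_lt_0_compat; [apply eps|]].
  generalize (Rabs_pos K); lra. }
exists (mkposreal _ Hp); refine (fun (y : C) Hy => _).
change (Cmod (y - z) < Rmin d (eps / (Rabs K + 1)))%R in Hy.
change (Cmod (f y - f z - (y - z) * l) <= eps * Cmod (y - z))%R.
assert (H1 := Rlt_le_trans _ _ _ Hy (Rmin_l _ _)).
assert (H2 := Rlt_le_trans _ _ _ Hy (Rmin_r _ _)).
destruct (Ceq_dec (y - z) 0) as [E|E].
- assert (Ey : y = z) by (replace y with (y - z + z)%C by ring; rewrite E; ring).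
  subst y.
  replace (f z - f z - (z - z) * l) with (RtoC 0) by ring.
  rewrite Cmod_0; apply Rmult_le_pos; [apply Rlt_le, eps|apply Cmod_ge_0].
- specialize (H _ E H1).
  replace (z + (y - z)) with y in H by ring.
  rewrite (Cmult_comm l) in H.
  apply (Rle_trans _ _ _ H).
  assert (Q := Cmod_ge_0 (y - z)).
  assert (T : ((Rabs K + 1) * Cmod (y - z) <= eps)%R).
  { apply Rlt_le, (Rmult_le_compat_l (Rabs K + 1)) in H2.
    - replace (pos eps) with ((Rabs K + 1) * (eps / (Rabs K + 1)))%R; [exact H2|].
      field; generalize (Rabs_pos K); lra.
    - generalize (Rabs_pos K); lra. }
  assert (T2 := Rle_abs K).
  assert (T3 : (K * Cmod (y - z) <= eps)%R) by nra.
  simpl; nra.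
Qed.

Lemma pseries_sum_le b z l M :
  c_is_pseries b z l -> (forall n, (Cmod (partial_sum b z n) <= M)%R) -> (Cmod l <= M)%R.
Proof.
rewrite c_is_pseries_eps; intros H HM.
apply Rnot_lt_le; intros Hlt.
destruct (H (Cmod l - M)%R) as [N HN]; [lra|].
specialize (HN N (le_n N)); specialize (HM N).
assert (T := Cmod_triangle (partial_sum b z N) (l - partial_sum b z N)).
replace (partial_sum b z N + (l - partial_sum b z N)) with l in T by ring.
rewrite <- Cmod_opp in HN.
replace (- (partial_sum b z N - l)) with (l - partial_sum b z N) in HN by ring.
lra.
Qed.

Lemma pseries_terms_bounded b z l :
  c_is_pseries b z l -> exists K, forall n, (Cmod (b n) * Cmod z ^ n <= K)%R.
Proof.
rewrite c_is_pseries_eps; intros H.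
destruct (H 1%R Rlt_0_1) as [N HN].
assert (HT : forall n, (N <= n)%nat -> (Cmod (b (S n)) * Cmod z ^ (S n) <= 2)%R).
{ intros n Hn.
  assert (H1 := HN n Hn); assert (H2 := HN (S n) (le_S _ _ Hn)).
  rewrite <- Cmod_pow, <- Cmod_mult.
  rewrite partial_sum_S in H2.
  replace (b (S n) * z ^ S n) with
    (partial_sum b z n + b (S n) * z ^ S n - l + - (partial_sum b z n - l)) by ring.
  eapply Rle_trans; [apply Cmod_triangle|]; rewrite Cmod_opp; lra. }
assert (HF : forall m, exists K, forall n, (n <= m)%nat -> (Cmod (b n) * Cmod z ^ n <= K)%R).
{ induction m as [|m [K HK]].
  - exists (Cmod (b 0%nat) * Cmod z ^ 0)%R; intros n Hn; replace n with 0%nat by lia; lra.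
  - exists (Rmax K (Cmod (b (S m)) * Cmod z ^ (S m)))%R; intros n Hn.
    destruct (Nat.eq_dec n (S m)) as [->|Hne]; [apply Rmax_r|].
    eapply Rle_trans; [apply HK; lia|apply Rmax_l]. }
destruct (HF N) as [K HK].
exists (Rmax K 2); intros n.
destruct (Nat.le_gt_cases n N) as [L|L].
- eapply Rle_trans; [now apply HK|apply Rmax_l].
- destruct n as [|n]; [lia|].
  eapply Rle_trans; [apply HT; lia|apply Rmax_r].
Qed.

(** Passing to the real series of moduli gives access to the radius of
    convergence of real power series, and to its invariance under term-by-term
    differentiation. *)
Lemma radius_of_moduli b r rho :
  (0 <= rho < r)%R -> (forall z, (Cmod z < r)%R -> exists l, c_is_pseries b z l) ->
  Rbar_lt rho (CV_radius (fun n => Cmod (b n))).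
Proof.
intros Hr H.
set (s := ((rho + r) / 2)%R).
assert (Hs : Cmod (RtoC s) = s) by (rewrite Cmod_R; apply Rabs_pos_eq; unfold s; lra).
destruct (H (RtoC s)) as [l Hl]; [rewrite Hs; unfold s; lra|].
destruct (pseries_terms_bounded _ _ _ Hl) as [K HK].
apply (Rbar_lt_le_trans _ s); [simpl; unfold s; lra|].
apply (proj1 (CV_radius_bounded (fun n => Cmod (b n)))).
exists K; intros n.
rewrite Rabs_pos_eq.
- rewrite <- Hs at 1; apply HK.
- apply Rmult_le_pos; [apply Cmod_ge_0|apply pow_le; unfold s; lra].
Qed.

Lemma nonneg_partial_sums_bounded (a : nat -> R) (rho : R) :
  (0 <= rho)%R -> (forall n, (0 <= a n)%R) -> Rbar_lt rho (CV_radius a) ->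
  exists M, forall n, (sum_n (fun k => a k * rho ^ k)%R n <= M)%R.
Proof.
intros Hr Ha H.
assert (HE : ex_pseries a rho) by (apply CV_radius_inside; now rewrite Rabs_pos_eq).
destruct HE as [l Hl]; apply is_pseries_R in Hl.
exists l; apply is_lim_seq_incr_compare; [exact Hl|].
intros n; rewrite sum_Sn; change plus with Rplus.
assert (0 <= a (S n) * rho ^ (S n))%R; [|simpl in *; lra].
apply Rmult_le_pos; [apply Ha|now apply pow_le].
Qed.

Lemma partial_sum_le b z rho n :
  (Cmod z <= rho)%R ->
  (Cmod (partial_sum b z n) <= sum_n (fun k => Cmod (b k) * rho ^ k)%R n)%R.
Proof.
intros Hz; induction n as [|n IH].
- rewrite partial_sum_0, sum_O; simpl; lra.
- rewrite partial_sum_S, sum_Sn; change plus with Rplus.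
  eapply Rle_trans; [apply Cmod_triangle|].
  apply Rplus_le_compat; [exact IH|].
  rewrite Cmod_mult, Cmod_pow.
  apply Rmult_le_compat_l; [apply Cmod_ge_0|].
  apply pow_incr; split; [apply Cmod_ge_0|exact Hz].
Qed.

Lemma pseries_bounded b r u :
  (0 < r)%R -> (forall z, (Cmod z < r)%R -> exists l, c_is_pseries b z l) ->
  exists K, forall z, (Cmod z < r / 2)%R -> c_is_pseries b z (u z) -> (Cmod (u z) <= K)%R.
Proof.
intros Hr H.
destruct (nonneg_partial_sums_bounded (fun n => Cmod (b n)) (r / 2)) as [M HM].
- lra.
- intros n; apply Cmod_ge_0.
- apply radius_of_moduli with r; [lra|exact H].
- exists M; intros z Hz Hu.
  apply (pseries_sum_le _ _ _ _ Hu); intros n.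
  eapply Rle_trans; [|apply HM].
  apply partial_sum_le; lra.
Qed.

Definition derived (b : nat -> C) (n : nat) : C := INR (S n) * b (S n).

Lemma Cmod_derived b n : Cmod (derived b n) = PS_derive (fun k => Cmod (b k)) n.
Proof.
unfold derived, PS_derive; rewrite Cmod_mult, Cmod_R, Rabs_pos_eq; [reflexivity|apply pos_INR].
Qed.

(** Induction on n: with d(n) = (w + k)^n - w^n - n k w^(n-1), one has
    d(n+1) = (w + k) d(n) + n k^2 w^(n-1). The constant (n+1)(n+2) is chosen
    because it is the coefficient of a twice differentiated series. *)
Lemma power_quadratic_error (w k : C) (rho : R) (n : nat) :
  (Cmod w <= rho)%R -> (Cmod (w + k) <= rho)%R ->
  (Cmod ((w + k) ^ (S (S n)) - w ^ (S (S n)) - INR (S (S n)) * k * w ^ (S n))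
   <= INR (S n) * INR (S (S n)) * rho ^ n * Cmod k ^ 2)%R.
Proof.
intros Hw Hwk.
assert (HR : (0 <= rho)%R) by (eapply Rle_trans; [apply Cmod_ge_0|exact Hw]).
induction n as [|n IH].
- replace ((w + k) ^ 2 - w ^ 2 - INR 2 * k * w ^ 1) with (k ^ 2).
  + rewrite Cmod_pow; simpl; generalize (Cmod_ge_0 k); nra.
  + replace (RtoC (INR 2)) with (1 + 1) by (rewrite <- RtoC_plus; f_equal; simpl; ring).
    simpl; ring.
- replace ((w + k) ^ S (S (S n)) - w ^ S (S (S n)) - INR (S (S (S n))) * k * w ^ S (S n))
    with ((w + k) * ((w + k) ^ S (S n) - w ^ S (S n) - INR (S (S n)) * k * w ^ S n)
          + INR (S (S n)) * k ^ 2 * w ^ S n).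
  2:{ rewrite (S_INR (S (S n))), RtoC_plus; simpl Cpow; ring. }
  eapply Rle_trans; [apply Cmod_triangle|].
  rewrite !Cmod_mult, !Cmod_pow, Cmod_R, Rabs_pos_eq by apply pos_INR.
  assert (P1 : (Cmod (w + k) * Cmod ((w + k) ^ S (S n) - w ^ S (S n) - INR (S (S n)) * k * w ^ S n)
     <= rho * (INR (S n) * INR (S (S n)) * rho ^ n * Cmod k ^ 2))%R).
  { apply Rmult_le_compat; try apply Cmod_ge_0; assumption. }
  assert (P2 : (INR (S (S n)) * Cmod k ^ 2 * Cmod w ^ S n <= INR (S (S n)) * Cmod k ^ 2 * rho ^ S n)%R).
  { apply Rmult_le_compat_l.
    - apply Rmult_le_pos; [apply pos_INR|apply pow2_ge_0].
    - apply pow_incr; split; [apply Cmod_ge_0|exact Hw]. }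
  assert (P3 : (0 <= INR (S (S n)) * Cmod k ^ 2 * rho ^ S n)%R).
  { apply Rmult_le_pos; [apply Rmult_le_pos; [apply pos_INR|apply pow2_ge_0]|now apply pow_le]. }
  rewrite (S_INR (S (S n))).
  replace (rho ^ S n)%R with (rho * rho ^ n)%R in * by reflexivity.
  rewrite !S_INR in *.
  nra.
Qed.

Lemma pseries_quadratic_error b w k rho n :
  (Cmod w <= rho)%R -> (Cmod (w + k) <= rho)%R ->
  (Cmod (partial_sum b (w + k) (S (S n)) - partial_sum b w (S (S n))
         - k * partial_sum (derived b) w (S n))
   <= sum_n (fun j => Cmod (derived (derived b) j) * rho ^ j)%R n * Cmod k ^ 2)%R.
Proof.
intros Hw Hwk; induction n as [|n IH].
- rewrite !partial_sum_S, !partial_sum_0, sum_O.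
  assert (H := power_quadratic_error w k rho 0 Hw Hwk).
  replace (b 0%nat + b 1%nat * (w + k) ^ 1 + b 2%nat * (w + k) ^ 2 -
    (b 0%nat + b 1%nat * w ^ 1 + b 2%nat * w ^ 2) -
    k * (derived b 0 + derived b 1 * w ^ 1))
   with (b 2%nat * ((w + k) ^ 2 - w ^ 2 - INR 2 * k * w ^ 1)).
  2:{ unfold derived; replace (RtoC (INR 1)) with (RtoC 1) by reflexivity; simpl Cpow; ring. }
  rewrite Cmod_mult.
  unfold derived; rewrite !Cmod_mult, !Cmod_R, !Rabs_pos_eq by apply pos_INR.
  apply (Rmult_le_compat_l (Cmod (b 2%nat))) in H; [|apply Cmod_ge_0].
  simpl in *; lra.
- rewrite (partial_sum_S b (w + k)), (partial_sum_S b w (S (S n))), (partial_sum_S (derived b)), sum_Sn.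
  change plus with Rplus.
  assert (H := power_quadratic_error w k rho (S n) Hw Hwk).
  match goal with |- (Cmod ?X <= _)%R => replace X with
   ((partial_sum b (w + k) (S (S n)) - partial_sum b w (S (S n))
         - k * partial_sum (derived b) w (S n)) +
   b (S (S (S n))) * ((w + k) ^ (S (S (S n))) - w ^ (S (S (S n))) - INR (S (S (S n))) * k * w ^ (S (S n)))) end.
  2:{ unfold derived at 3; ring. }
  eapply Rle_trans; [apply Cmod_triangle|].
  rewrite Rmult_plus_distr_r; apply Rplus_le_compat; [exact IH|].
  rewrite Cmod_mult.
  unfold derived; rewrite !Cmod_mult, !Cmod_R, !Rabs_pos_eq by apply pos_INR.
  apply (Rmult_le_compat_l (Cmod (b (S (S (S n)))))) in H; [|apply Cmod_ge_0].
  eapply Rle_trans; [exact H|]; apply Req_le; ring.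
Qed.

Lemma derived_convergent b r :
  (forall z, (Cmod z < r)%R -> exists l, c_is_pseries b z l) ->
  forall z, (Cmod z < r)%R -> exists l, c_is_pseries (derived b) z l.
Proof.
intros H z Hz.
assert (HR := radius_of_moduli b r (Cmod z) (conj (Cmod_ge_0 z) Hz) H).
rewrite <- CV_radius_derive in HR.
apply (@ex_series_le C_AbsRing C_CompleteNormedModule _
  (fun n => Rabs (PS_derive (fun k => Cmod (b k)) n * Cmod z ^ n))).
- intros n.
  change (Cmod (@pow_n C_AbsRing z n * derived b n) <= Rabs (PS_derive (fun k => Cmod (b k)) n * Cmod z ^ n))%R.
  rewrite pow_n_Cpow, Cmod_mult, Cmod_pow, Cmod_derived, Rmult_comm.
  apply Rle_abs.
- apply CV_disk_inside; rewrite Rabs_pos_eq; [exact HR|apply Cmod_ge_0].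
Qed.

(** Term-by-term differentiation. The partial sums satisfy
    |S(w + k) - S(w) - k S'(w)| <= M |k|^2, where M, the sum of the twice
    differentiated series of moduli at a radius rho between |w| and r, does not
    depend on the length of the sum; the inequality passes to the limit. *)
Lemma pseries_derivative b r f z0 :
  (forall h, (Cmod h < r)%R -> c_is_pseries b h (f (z0 + h)%C)) ->
  forall w, (Cmod w < r)%R -> c_is_pseries (derived b) w (C_derive f (z0 + w)).
Proof.
intros H w Hw.
assert (Hb : forall z, (Cmod z < r)%R -> exists l, c_is_pseries b z l)
  by (intros z Hz; exists (f (z0 + z)); now apply H).
destruct (derived_convergent b r Hb w Hw) as [l Hl].
replace (C_derive f (z0 + w)) with l; [exact Hl|symmetry].
apply C_derive_of_quadratic_error.
(* room for both w and w + k below the radius of convergence *)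
set (rho := ((Cmod w + r) / 2)%R).
assert (Hrho : (0 <= rho)%R) by (unfold rho; generalize (Cmod_ge_0 w); lra).
assert (HD : Rbar_lt rho (CV_radius (fun n => Cmod (derived (derived b) n)))).
{ rewrite (CV_radius_ext _ _ (Cmod_derived _)), CV_radius_derive.
  rewrite (CV_radius_ext _ _ (Cmod_derived _)), CV_radius_derive.
  apply radius_of_moduli with r; [unfold rho in *; lra|exact Hb]. }
destruct (nonneg_partial_sums_bounded _ _ Hrho (fun n => Cmod_ge_0 _) HD) as [M HM].
exists ((r - Cmod w) / 2)%R, M; split; [lra|].
intros k _ Hk.
assert (Hwk : (Cmod (w + k) <= rho)%R).
{ eapply Rle_trans; [apply Cmod_triangle|unfold rho; lra]. }
assert (H1 : c_is_pseries b (w + k) (f (z0 + w + k))).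
{ replace (z0 + w + k) with (z0 + (w + k)) by ring; apply H; unfold rho in Hwk; lra. }
assert (H2 := H w Hw).
apply Rnot_lt_le; intros Hlt.
set (D := (Cmod (f (z0 + w + k) - f (z0 + w) - l * k)%C - M * Cmod k ^ 2)%R).
assert (HD0 : (0 < D / 4)%R) by (unfold D; lra).
assert (HD1 : (0 < D / 4 / (1 + Cmod k))%R).
{ apply Rdiv_lt_0_compat; [exact HD0|generalize (Cmod_ge_0 k); lra]. }
rewrite c_is_pseries_eps in H1, H2, Hl.
destruct (H1 _ HD0) as [N1 HN1], (H2 _ HD0) as [N2 HN2], (Hl _ HD1) as [N3 HN3].
set (n := (N1 + N2 + N3)%nat).
specialize (HN1 (S (S n)) ltac:(unfold n; lia)).
specialize (HN2 (S (S n)) ltac:(unfold n; lia)).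
specialize (HN3 (S n) ltac:(unfold n; lia)).
assert (HQ := pseries_quadratic_error b w k rho n ltac:(unfold rho; lra) Hwk).
assert (HQ2 : (Cmod (partial_sum b (w + k) (S (S n)) - partial_sum b w (S (S n))
         - k * partial_sum (derived b) w (S n)) <= M * Cmod k ^ 2)%R).
{ eapply Rle_trans; [exact HQ|]; apply Rmult_le_compat_r; [apply pow2_ge_0|apply HM]. }
assert (HK3 : (Cmod (k * (partial_sum (derived b) w (S n) - l)) <= D / 4)%R).
{ rewrite Cmod_mult.
  apply Rlt_le, (Rmult_le_compat_l (1 + Cmod k)) in HN3; [|generalize (Cmod_ge_0 k); lra].
  replace ((1 + Cmod k) * (D / 4 / (1 + Cmod k)))%R with (D / 4)%R in HN3
    by (field; generalize (Cmod_ge_0 k); lra).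
  generalize (Cmod_ge_0 (partial_sum (derived b) w (S n) - l)); lra. }
assert (HC : (Cmod (f (z0 + w + k) - f (z0 + w) - l * k)%C <= M * Cmod k ^ 2 + 3 * (D / 4))%R).
{ replace (f (z0 + w + k) - f (z0 + w) - l * k) with
   ((partial_sum b (w + k) (S (S n)) - partial_sum b w (S (S n))
         - k * partial_sum (derived b) w (S n))
    + (- (partial_sum b (w + k) (S (S n)) - f (z0 + w + k))
       + ((partial_sum b w (S (S n)) - f (z0 + w)) + k * (partial_sum (derived b) w (S n) - l)))) by ring.
  eapply Rle_trans; [apply Cmod_triangle|apply Rplus_le_compat; [exact HQ2|]].
  eapply Rle_trans; [apply Cmod_triangle|rewrite Cmod_opp].
  eapply Rle_trans; [apply Rplus_le_compat_l, Cmod_triangle|lra]. }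
unfold D in *; lra.
Qed.

Lemma pseries_at_0 b l : c_is_pseries b 0 l -> l = b 0%nat.
Proof.
rewrite c_is_pseries_eps; intros H.
assert (HS : forall n, partial_sum b 0 n = b 0%nat).
{ induction n as [|n IH]; [apply partial_sum_0|].
  rewrite partial_sum_S, IH; simpl; ring. }
destruct (Ceq_dec (b 0%nat - l) 0) as [E|E].
- replace l with (b 0%nat - (b 0%nat - l)) by ring; rewrite E; ring.
- apply Cmod_gt_0 in E; destruct (H _ E) as [N HN].
  specialize (HN N (le_n N)); rewrite HS in HN; lra.
Qed.

Lemma iter_derived n b k :
  INR (fact k) * Nat.iter n derived b k = INR (fact (n + k)) * b (n + k)%nat.
Proof.
revert k; induction n as [|n IH]; intros k; [reflexivity|].
change (Nat.iter (S n) derived b k) with (INR (S k) * Nat.iter n derived b (S k)).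
replace (S n + k)%nat with (n + S k)%nat by lia.
rewrite <- IH, fact_simpl, mult_INR, RtoC_mult; ring.
Qed.

Lemma taylor_coeff_pseries b r f n :
  (0 < r)%R -> (forall z, (Cmod z < r)%R -> c_is_pseries b z (f z)) ->
  taylor_coeff f n = b n.
Proof.
intros Hr H.
assert (HI : forall m z, (Cmod z < r)%R ->
  c_is_pseries (Nat.iter m derived b) z (Nat.iter m C_derive f z)).
{ induction m as [|m IH]; [exact H|]; intros z Hz; simpl.
  replace z with (0 + z) at 2 by ring.
  apply pseries_derivative with r; [|exact Hz].
  intros h Hh; rewrite Cplus_0_l; now apply IH. }
assert (H0 : (Cmod 0 < r)%R) by (rewrite Cmod_0; exact Hr).
unfold taylor_coeff.
rewrite (pseries_at_0 _ _ (HI n 0 H0)).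
assert (E := iter_derived n b 0).
rewrite Nat.add_0_r in E; simpl (fact 0) in E.
assert (HF : RtoC (INR (fact n)) <> 0).
{ intros HF; apply RtoC_inj in HF; exact (INR_fact_neq_0 n HF). }
replace (Nat.iter n derived b 0%nat) with (INR (fact n) * b n).
- field; exact HF.
- rewrite <- E; simpl; ring.
Qed.

(** * Second-order expansions *)

Definition bounded_near_0 (E : C -> C) : Prop :=
  exists d K : R, (0 < d)%R /\
    forall h : C, h <> 0 -> (Cmod h < d)%R -> (Cmod (E h) <= K)%R.

Definition eq_near_0 (u v : C -> C) : Prop :=
  exists d : R, (0 < d)%R /\ forall h : C, h <> 0 -> (Cmod h < d)%R -> u h = v h.

(** The expansion u(h) = A + B h + D h^2 + O(h^3). The value of u at 0 is left
    free, so that removable singularities need no treatment of their own. *)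
Definition jet (u : C -> C) (A B D : C) : Prop :=
  bounded_near_0 (fun h => (u h - (A + B * h + D * h ^ 2)) / h ^ 3).

Lemma bounded_near_0_ext u v :
  eq_near_0 u v -> bounded_near_0 u -> bounded_near_0 v.
Proof.
intros (d & Hd & H) (d' & K & Hd' & HK).
exists (Rmin d d'), K; split; [now apply Rmin_pos|].
intros h Hh Hl.
rewrite <- H; [apply HK|exact Hh|]; try exact Hh;
  eapply Rlt_le_trans; try exact Hl; [apply Rmin_r|apply Rmin_l].
Qed.

Lemma eq_near_0_everywhere (u v : C -> C) : (forall h : C, h <> 0 -> u h = v h) -> eq_near_0 u v.
Proof. intros H; exists 1%R; split; [lra|auto]. Qed.

Lemma bounded_near_0_const c : bounded_near_0 (fun _ => c).
Proof. exists 1%R, (Cmod c); split; [lra|intros; lra]. Qed.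

Lemma bounded_near_0_id : bounded_near_0 (fun h => h).
Proof. exists 1%R, 1%R; split; [lra|intros; lra]. Qed.

Lemma bounded_near_0_plus u v :
  bounded_near_0 u -> bounded_near_0 v -> bounded_near_0 (fun h => u h + v h).
Proof.
intros (d & K & Hd & HK) (d' & K' & Hd' & HK').
exists (Rmin d d'), (K + K')%R; split; [now apply Rmin_pos|].
intros h Hh Hl; eapply Rle_trans; [apply Cmod_triangle|].
apply Rplus_le_compat; [apply HK|apply HK']; try exact Hh;
  eapply Rlt_le_trans; try exact Hl; [apply Rmin_l|apply Rmin_r].
Qed.

Lemma bounded_near_0_mult u v :
  bounded_near_0 u -> bounded_near_0 v -> bounded_near_0 (fun h => u h * v h).
Proof.
intros (d & K & Hd & HK) (d' & K' & Hd' & HK').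
exists (Rmin d d'), (K * K')%R; split; [now apply Rmin_pos|].
intros h Hh Hl; rewrite Cmod_mult.
apply Rmult_le_compat; try apply Cmod_ge_0; [apply HK|apply HK']; try exact Hh;
  eapply Rlt_le_trans; try exact Hl; [apply Rmin_l|apply Rmin_r].
Qed.

Ltac prove_bounded :=
  repeat first
   [ assumption
   | apply bounded_near_0_const | apply bounded_near_0_id
   | apply bounded_near_0_plus | apply bounded_near_0_mult ].

Lemma jet_ext u v A B D : eq_near_0 u v -> jet u A B D -> jet v A B D.
Proof.
intros (d & Hd & H); apply bounded_near_0_ext.
exists d; split; [exact Hd|]; intros h Hh Hl; now rewrite H.
Qed.

Lemma jet_bounded u A B D : jet u A B D -> bounded_near_0 u.
Proof.
intros H; unfold jet in H.
apply bounded_near_0_ext with (fun h => h * h * h * ((u h - (A + B * h + D * h ^ 2)) / h ^ 3)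
  + (A + B * h + D * (h * h))).
- apply eq_near_0_everywhere; intros h Hh; simpl; field; exact Hh.
- prove_bounded.
Qed.

Lemma jet_const c : jet (fun _ => c) c 0 0.
Proof.
apply bounded_near_0_ext with (fun _ => 0); [|apply bounded_near_0_const].
apply eq_near_0_everywhere; intros h Hh; field; exact Hh.
Qed.

Lemma jet_translation c : jet (fun h => c + h) c 1 0.
Proof.
apply bounded_near_0_ext with (fun _ => 0); [|apply bounded_near_0_const].
apply eq_near_0_everywhere; intros h Hh; field; exact Hh.
Qed.

Lemma jet_coeffs u A B D A' B' D' :
  A = A' -> B = B' -> D = D' -> jet u A B D -> jet u A' B' D'.
Proof. now intros -> -> ->. Qed.

Lemma jet_plus u v A B D A' B' D' :
  jet u A B D -> jet v A' B' D' -> jet (fun h => u h + v h) (A + A') (B + B') (D + D').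
Proof.
intros H H'.
eapply bounded_near_0_ext; [|exact (bounded_near_0_plus _ _ H H')].
apply eq_near_0_everywhere; intros h Hh; simpl; field; exact Hh.
Qed.

Lemma jet_mult u v A B D A' B' D' :
  jet u A B D -> jet v A' B' D' ->
  jet (fun h => u h * v h) (A * A') (A * B' + B * A') (A * D' + B * B' + D * A').
Proof.
intros H H'.
assert (Hv := jet_bounded _ _ _ _ H').
unfold jet in H, H'.
apply bounded_near_0_ext with (fun h =>
  (u h - (A + B * h + D * h ^ 2)) / h ^ 3 * v h
  + (A + B * h + D * (h * h)) * ((v h - (A' + B' * h + D' * h ^ 2)) / h ^ 3)
  + (B * D' + D * B' + D * D' * h)).
- apply eq_near_0_everywhere; intros h Hh; simpl; field; exact Hh.
- prove_bounded.
Qed.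

Lemma jet_scal c u A B D : jet u A B D -> jet (fun h => c * u h) (c * A) (c * B) (c * D).
Proof.
intros H; eapply jet_coeffs; [| | |exact (jet_mult _ _ _ _ _ _ _ _ (jet_const c) H)]; ring.
Qed.

Lemma jet_first_order u A B D :
  jet u A B D -> exists d K : R, (0 < d)%R /\ forall h : C, h <> 0 -> (Cmod h < d)%R ->
    (Cmod (u h - A - B * h)%C <= K * Cmod h ^ 2)%R.
Proof.
intros H; unfold jet in H.
assert (HB : bounded_near_0 (fun h => (u h - A - B * h) / (h * h))).
{ apply bounded_near_0_ext with (fun h => h * ((u h - (A + B * h + D * h ^ 2)) / h ^ 3) + D).
  - apply eq_near_0_everywhere; intros h Hh; simpl; field; exact Hh.
  - prove_bounded. }
destruct HB as (d & K & Hd & HK).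
exists d, K; split; [exact Hd|]; intros h Hh Hl.
specialize (HK h Hh Hl).
replace (u h - A - B * h) with ((u h - A - B * h) / (h * h) * (h * h)) by (field; exact Hh).
rewrite Cmod_mult, (Cmod_mult h h); simpl.
rewrite Rmult_1_r; apply Rmult_le_compat_r; [|exact HK].
apply Rmult_le_pos; apply Cmod_ge_0.
Qed.

Lemma jet_zeroth_order u A B D :
  jet u A B D -> exists d K : R, (0 < d)%R /\ (0 <= K)%R /\ forall h : C, h <> 0 -> (Cmod h < d)%R ->
    (Cmod (u h - A)%C <= K * Cmod h)%R.
Proof.
intros H; unfold jet in H.
assert (HB : bounded_near_0 (fun h => (u h - A) / h)).
{ apply bounded_near_0_ext with (fun h => h * h * ((u h - (A + B * h + D * h ^ 2)) / h ^ 3) + (D * h + B)).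
  - apply eq_near_0_everywhere; intros h Hh; simpl; field; exact Hh.
  - prove_bounded. }
destruct HB as (d & K & Hd & HK).
exists d, (Rabs K); split; [exact Hd|]; split; [apply Rabs_pos|]; intros h Hh Hl.
specialize (HK h Hh Hl).
replace (u h - A) with ((u h - A) / h * h) by (field; exact Hh).
rewrite Cmod_mult.
apply Rmult_le_compat_r; [apply Cmod_ge_0|].
eapply Rle_trans; [exact HK|apply Rle_abs].
Qed.

Lemma jet_nonzero u (A B D : C) :
  A <> 0 -> jet u A B D ->
  exists d m : R, (0 < d)%R /\ (0 < m)%R /\ forall h : C, h <> 0 -> (Cmod h < d)%R -> (m <= Cmod (u h))%R.
Proof.
intros HA H.
destruct (jet_zeroth_order _ _ _ _ H) as (d & K & Hd & HK0 & HK).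
assert (HA1 := proj1 (Cmod_gt_0 A) HA).
exists (Rmin d (Cmod A / (2 * (K + 1))))%R, (Cmod A / 2)%R.
assert (0 < Cmod A / (2 * (K + 1)))%R by (apply Rdiv_lt_0_compat; lra).
split; [now apply Rmin_pos|split; [lra|]].
intros h Hh Hl.
assert (H1 := Rlt_le_trans _ _ _ Hl (Rmin_l _ _)).
assert (H2 := Rlt_le_trans _ _ _ Hl (Rmin_r _ _)).
specialize (HK h Hh H1).
assert (T := Cmod_triangle (u h) (- (u h - A))).
replace (u h + - (u h - A)) with A in T by ring; rewrite Cmod_opp in T.
apply Rlt_le, (Rmult_le_compat_l (2 * (K + 1))) in H2; [|lra].
replace (2 * (K + 1) * (Cmod A / (2 * (K + 1))))%R with (Cmod A) in H2 by (field; lra).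
generalize (Cmod_ge_0 h); nra.
Qed.

(** With Q the announced expansion of 1/u, the product u Q is 1 + O(h^3), and
    1/u - Q = (1 - u Q)/u where 1/u is bounded near 0 since A <> 0. *)
Lemma jet_inv u (A B D : C) :
  A <> 0 -> jet u A B D ->
  jet (fun h => / u h) (/ A) (- (B / A ^ 2)) (B ^ 2 / A ^ 3 - D / A ^ 2).
Proof.
intros HA H.
assert (HP : jet (fun h => (1 - u h * (/ A - B / A ^ 2 * h + (B ^ 2 / A ^ 3 - D / A ^ 2) * h ^ 2))) 0 0 0).
{ assert (HQ : jet (fun h => / A - B / A ^ 2 * h + (B ^ 2 / A ^ 3 - D / A ^ 2) * h ^ 2)
    (/ A) (- (B / A ^ 2)) (B ^ 2 / A ^ 3 - D / A ^ 2)).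
  { apply bounded_near_0_ext with (fun _ => 0); [|apply bounded_near_0_const].
    apply eq_near_0_everywhere; intros h Hh; field; split; assumption. }
  assert (HM := jet_plus _ _ _ _ _ _ _ _ (jet_const 1) (jet_scal (- (1)) _ _ _ _ (jet_mult _ _ _ _ _ _ _ _ H HQ))).
  eapply jet_coeffs; [| | |eapply jet_ext; [|exact HM]].
  - field; assumption.
  - field; assumption.
  - field; assumption.
  - apply eq_near_0_everywhere; intros h Hh; ring. }
destruct (jet_nonzero u A B D HA H) as (d & m & Hd & Hm & Hu).
assert (HI : bounded_near_0 (fun h => / u h)).
{ exists d, (/ m)%R; split; [exact Hd|]; intros h Hh Hl.
  specialize (Hu h Hh Hl).
  rewrite Cmod_inv by (apply Cmod_gt_0; lra).
  apply Rinv_le_contravar; assumption. }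
apply bounded_near_0_ext with (2 := bounded_near_0_mult _ _ HP HI).
exists d; split; [exact Hd|]; intros h Hh Hl.
specialize (Hu h Hh Hl).
field; repeat split; try assumption; apply Cmod_gt_0; lra.
Qed.

Lemma jet_reflect u A B D : jet u A B D -> jet (fun h => u (- h)) A (- B) D.
Proof.
intros (d & K & Hd & HK); exists d, K; split; [exact Hd|].
intros h Hh Hl.
assert (Hh' : - h <> 0) by (intros E; apply Hh; replace h with (- - h) by ring; rewrite E; ring).
specialize (HK (- h) Hh' ltac:(now rewrite Cmod_opp)).
rewrite <- Cmod_opp.
match type of HK with (Cmod ?X <= _)%R => match goal with |- (Cmod ?Y <= _)%R => replace Y with X end end.
- exact HK.
- field; exact Hh.
Qed.

(** Dividing off the first coefficient: the tails obtained in this way are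
    again power series, hence bounded, which is how expansions are read off. *)
Lemma pseries_shift b (h l : C) :
  h <> 0 -> c_is_pseries b h l -> c_is_pseries (fun n => b (S n)) h ((l - b 0%nat) / h).
Proof.
intros Hh H.
assert (E : (/ h * h)%C = 1) by (field; exact Hh).
assert (T := is_pseries_decr_1 (K := C_AbsRing) (V := C_NormedModule) b h (/ h) l E H).
unfold c_is_pseries.
replace ((l - b 0%nat) / h) with (scal (/ h : C_AbsRing) (plus l (opp (b 0%nat)) : C_NormedModule)).
- exact T.
- change (/ h * (l + - b 0%nat) = (l - b 0%nat) / h); field; exact Hh.
Qed.

Lemma pseries_bounded_near_0 b r u :
  (0 < r)%R -> (forall h : C, h <> 0 -> (Cmod h < r)%R -> c_is_pseries b h (u h)) ->
  bounded_near_0 u.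
Proof.
intros Hr H.
destruct (pseries_bounded b r u Hr) as [K HK].
- intros z Hz; destruct (Ceq_dec z 0) as [->|E].
  + exists (b 0%nat); apply (@is_pseries_0 C_AbsRing C_NormedModule).
  + exists (u z); now apply H.
- exists (r / 2)%R, K; split; [lra|]; intros h Hh Hl.
  apply HK; [exact Hl|apply H; [exact Hh|lra]].
Qed.

Lemma pseries_jet b r u :
  (0 < r)%R -> (forall h : C, h <> 0 -> (Cmod h < r)%R -> c_is_pseries b h (u h)) ->
  jet u (b 0%nat) (b 1%nat) (b 2%nat).
Proof.
intros Hr H.
apply bounded_near_0_ext with (fun h => (((u h - b 0%nat) / h - b 1%nat) / h - b 2%nat) / h).
- apply eq_near_0_everywhere; intros h Hh; field; exact Hh.
- apply (pseries_bounded_near_0 (fun n => b (S (S (S n)))) r _ Hr).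
  intros h Hh Hl.
  apply (pseries_shift (fun n => b (S (S n)))); [exact Hh|].
  apply (pseries_shift (fun n => b (S n))); [exact Hh|].
  apply (pseries_shift b); [exact Hh|now apply H].
Qed.

(** * Maximum principle *)

Lemma Cmod_le_coords (z : C) : (Cmod z <= Rabs (Re z) + Rabs (Im z))%R.
Proof.
assert (H1 := Rabs_pos (Re z)); assert (H2 := Rabs_pos (Im z)).
apply Rsqr_incr_0_var; [|lra].
rewrite !Rsqr_pow2, Cmod2_alt, <- (pow2_abs (Re z)), <- (pow2_abs (Im z)); nra.
Qed.

(** Compactness of the closed disk in the form of a Lebesgue number: the radii d
    that occur are bounded below by d0, uniformly in x. It is deduced from the
    same fact for a square, points outside the disk getting a radius too small
    for their neighbourhood to reach it. *)
Lemma disk_cover (rho : R) (P : C -> R -> Prop) :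
  (forall z, (Cmod z <= rho)%R -> exists d, (0 < d)%R /\ P z d) ->
  exists d0, (0 < d0)%R /\ forall x, (Cmod x <= rho)%R ->
    exists z d, (Cmod z <= rho)%R /\ P z d /\ (d0 <= d)%R /\ (Cmod (x - z) < d)%R.
Proof.
intros H.
assert (HD : forall z, exists d : posreal,
  ((Cmod z <= rho)%R -> P z (2 * d)%R) /\ ((rho < Cmod z)%R -> (2 * d <= Cmod z - rho)%R)).
{ intros z; destruct (Rle_lt_dec (Cmod z) rho) as [L|L].
  - destruct (H z L) as (d & Hd & HP).
    exists (mkposreal (d / 2) ltac:(lra)); simpl; split; [|lra].
    intros _; replace (2 * (d / 2))%R with d by field; exact HP.
  - exists (mkposreal ((Cmod z - rho) / 2) ltac:(lra)); simpl; split; [lra|intros _; lra]. }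
set (delta := fun z => proj1_sig (constructive_indefinite_description _ (HD z))).
assert (Hdelta : forall z,
  ((Cmod z <= rho)%R -> P z (2 * delta z)%R) /\ ((rho < Cmod z)%R -> (2 * delta z <= Cmod z - rho)%R)).
{ intros z; exact (proj2_sig (constructive_indefinite_description _ (HD z))). }
clearbody delta.
destruct (compactness_value_2d (- rho) rho (- rho) rho (fun x y => delta (x, y))) as [d0 Hd0].
exists d0; split; [apply cond_pos|].
intros x Hx.
assert (Hx1 := Rmax_Cmod x).
assert (Hx2 := Rle_trans _ _ _ (Rmax_l _ _) (Rle_trans _ _ _ Hx1 Hx)).
assert (Hx3 := Rle_trans _ _ _ (Rmax_r _ _) (Rle_trans _ _ _ Hx1 Hx)).
apply Rabs_le_between in Hx2; apply Rabs_le_between in Hx3.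
assert (HE := NNPP _ (Hd0 _ _ Hx2 Hx3)).
destruct HE as (a & b & Ha & Hb & H1 & H2 & H3).
set (z := (a, b) : C).
assert (HL : (Cmod (x - z) < 2 * delta z)%R).
{ eapply Rle_lt_trans; [apply Cmod_le_coords|].
  change (Rabs (fst x - a) + Rabs (snd x - b) < 2 * delta z)%R; unfold z; lra. }
destruct (Hdelta z) as [HI HO].
destruct (Rle_lt_dec (Cmod z) rho) as [L|L].
- exists z, (2 * delta z)%R; repeat split; [exact L|now apply HI| |exact HL].
  fold z in H3; generalize (cond_pos (delta z)); lra.
- exfalso; specialize (HO L).
  assert (T := Cmod_triangle x (- (x - z))).
  replace (x + - (x - z)) with z in T by ring; rewrite Cmod_opp in T; lra.
Qed.

(** If the supremum S were not attained, cover by neighbourhoods on which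
    v <= S - (S - v z)/2, of radius at most (S - v z)/2; the uniform lower bound
    d1 on the radii then bounds v by S - d1. Boundedness is obtained
    likewise. *)
Lemma usc_attains_max (v : C -> R) (rho : R) :
  (0 <= rho)%R ->
  (forall z, (Cmod z <= rho)%R -> forall e, (0 < e)%R -> exists d, (0 < d)%R /\
     forall w, (Cmod w <= rho)%R -> (Cmod (w - z) < d)%R -> (v w < v z + e)%R) ->
  exists m, (Cmod m <= rho)%R /\ forall w, (Cmod w <= rho)%R -> (v w <= v m)%R.
Proof.
intros Hrho H.
assert (H0 : (Cmod 0 <= rho)%R) by (now rewrite Cmod_0).
destruct (disk_cover rho (fun z d => (d * (1 + Rabs (v z)) <= 1)%R /\
   forall w, (Cmod w <= rho)%R -> (Cmod (w - z) < d)%R -> (v w < v z + 1)%R)) as (d0 & Hd0 & HB).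
{ intros z Hz; destruct (H z Hz 1%R Rlt_0_1) as (d & Hd & Hw).
  assert (HA := Rabs_pos (v z)).
  assert (HI : (0 < / (1 + Rabs (v z)))%R) by (apply Rinv_0_lt_compat; lra).
  exists (Rmin d (/ (1 + Rabs (v z)))); split; [now apply Rmin_pos|split].
  - eapply Rle_trans; [apply Rmult_le_compat_r; [lra|apply Rmin_r]|]; apply Req_le; field; lra.
  - intros w Hw1 Hw2; apply Hw; [exact Hw1|eapply Rlt_le_trans; [exact Hw2|apply Rmin_l]]. }
destruct (completeness (fun y => exists w, (Cmod w <= rho)%R /\ y = v w)) as [S [HS1 HS2]].
- exists (/ d0 + 1)%R; intros y (w & Hw & ->).
  destruct (HB w Hw) as (z & d & Hz & [Hd1 Hd2] & Hdd & Hwz).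
  specialize (Hd2 w Hw Hwz).
  assert (HA := Rabs_pos (v z)); assert (HA2 := Rle_abs (v z)).
  assert (HL : (v z <= / d0)%R).
  { apply (Rmult_le_reg_l d0); [exact Hd0|]; rewrite Rinv_r by lra; nra. }
  lra.
- exists (v 0); exists 0; split; [exact H0|reflexivity].
- apply NNPP; intros HN.
  assert (HS : forall z, (Cmod z <= rho)%R -> (v z < S)%R).
  { intros z Hz; destruct (Rle_lt_or_eq_dec (v z) S) as [L|E]; [|exact L|].
    - apply HS1; now exists z.
    - exfalso; apply HN; exists z; split; [exact Hz|].
      intros w Hw; rewrite E; apply HS1; now exists w. }
  destruct (disk_cover rho (fun z d => (d <= (S - v z) / 2)%R /\
   forall w, (Cmod w <= rho)%R -> (Cmod (w - z) < d)%R -> (v w < v z + (S - v z) / 2)%R)) as (d1 & Hd1 & HC).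
  { intros z Hz; specialize (HS z Hz).
    destruct (H z Hz ((S - v z) / 2)%R ltac:(lra)) as (d & Hd & Hw).
    exists (Rmin d ((S - v z) / 2)); split; [apply Rmin_pos; lra|split; [apply Rmin_r|]].
    intros w Hw1 Hw2; apply Hw; [exact Hw1|eapply Rlt_le_trans; [exact Hw2|apply Rmin_l]]. }
  assert (HU : (S <= S - d1)%R).
  { apply HS2; intros y (w & Hw & ->).
    destruct (HC w Hw) as (z & d & Hz & [Hz1 Hz2] & Hdd & Hwz).
    specialize (Hz2 w Hw Hwz); lra. }
  lra.
Qed.

(** The first and second powers of the four fourth roots of 1 sum to 0. *)
Lemma four_point_mean u A B D :
  jet u A B D -> exists d K : R, (0 < d)%R /\ forall s : R, (0 < s < d)%R ->
    (Cmod (u (RtoC s) + u (- RtoC s) + u (Ci * s) + u (- (Ci * s)) - 4 * A)%C <= K * s ^ 3)%R.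
Proof.
intros (d & K & Hd & HK); exists d, (4 * K)%R; split; [exact Hd|].
intros s Hs.
assert (HR : forall h : C, Cmod h = s -> (Cmod (u h - (A + B * h + D * h ^ 2))%C <= K * s ^ 3)%R).
{ intros h Hh.
  assert (Hh0 : h <> 0) by (apply Cmod_gt_0; lra).
  specialize (HK h Hh0 ltac:(lra)).
  replace (u h - (A + B * h + D * h ^ 2)) with ((u h - (A + B * h + D * h ^ 2)) / h ^ 3 * h ^ 3) by (field; exact Hh0).
  rewrite Cmod_mult, Cmod_pow, Hh; apply Rmult_le_compat_r; [apply pow_le; lra|exact HK]. }
assert (M : Cmod (RtoC s) = s) by (rewrite Cmod_R; apply Rabs_pos_eq; lra).
assert (Mi : Cmod (Ci * s) = s) by (rewrite Cmod_mult, M, Cmod_Ci; ring).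
assert (H1 := HR (RtoC s) M).
assert (H2 := HR (- RtoC s) ltac:(now rewrite Cmod_opp)).
assert (H3 := HR (Ci * s) Mi).
assert (H4 := HR (- (Ci * s)) ltac:(now rewrite Cmod_opp)).
match type of H1 with (Cmod ?X <= _)%R => match type of H2 with (Cmod ?Y <= _)%R =>
match type of H3 with (Cmod ?Z <= _)%R => match type of H4 with (Cmod ?W <= _)%R =>
  assert (T1 := Cmod_triangle X Y); assert (T2 := Cmod_triangle (X + Y) Z);
  assert (T3 := Cmod_triangle (X + Y + Z) W);
  replace (u (RtoC s) + u (- RtoC s) + u (Ci * s) + u (- (Ci * s)) - 4 * A) with (X + Y + Z + W)
end end end end.
- lra.
- assert (I2 : Ci * Ci = - (1)) by (unfold Ci, Cmult, Copp, RtoC; simpl; f_equal; ring).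
  replace (RtoC 4) with (1 + 1 + 1 + 1) by (rewrite <- !RtoC_plus; f_equal; ring).
  transitivity (u s + u (- s) + u (Ci * s) + u (- (Ci * s)) - (1 + 1 + 1 + 1) * A
     - (1 + 1) * D * s ^ 2 * (1 + Ci * Ci)); [ring|].
  rewrite I2; ring.
Qed.

(** From |w|^2 >= 2 Re(conj(A) w) - |A|^2 and the four-point mean, the average of
    |u(h)|^2 over s, -s, is, -is is at least |A|^2 - O(s^3), whereas that of
    eps |z + h|^2 is exactly eps |z|^2 + eps s^2. *)
Lemma no_interior_max (u : C -> C) (A B D z : C) (eps d : R) :
  jet u A B D -> (0 < eps)%R -> (0 < d)%R ->
  exists h : C, h <> 0 /\ (Cmod h < d)%R /\
    (Cmod A ^ 2 + eps * Cmod z ^ 2 < Cmod (u h) ^ 2 + eps * Cmod (z + h) ^ 2)%R.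
Proof.
intros HJ He Hd.
destruct (four_point_mean _ _ _ _ HJ) as (d1 & K & Hd1 & HK).
apply NNPP; intros HN.
assert (HM : forall h : C, h <> 0 -> (Cmod h < d)%R ->
  (Cmod (u h) ^ 2 + eps * Cmod (z + h) ^ 2 <= Cmod A ^ 2 + eps * Cmod z ^ 2)%R).
{ intros h Hh Hl; apply Rnot_lt_le; intros L; apply HN; now exists h. }
set (b := (Cmod A * Rabs K + 1)%R).
assert (Hb : (0 < b)%R).
{ unfold b; generalize (Rmult_le_pos _ _ (Cmod_ge_0 A) (Rabs_pos K)); lra. }
set (s := (Rmin (Rmin d d1) (eps / b) / 2)%R).
assert (Heb : (0 < eps / b)%R) by (now apply Rdiv_lt_0_compat).
assert (Hs : (0 < s /\ s < d /\ s < d1 /\ s < eps / b)%R).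
{ assert (P : (0 < Rmin (Rmin d d1) (eps / b))%R) by (repeat apply Rmin_pos; assumption).
  assert (P1 := Rmin_l (Rmin d d1) (eps / b)); assert (P2 := Rmin_r (Rmin d d1) (eps / b)).
  assert (P3 := Rmin_l d d1); assert (P4 := Rmin_r d d1); unfold s; lra. }
destruct Hs as (Hs0 & Hs1 & Hs2 & Hs3).
assert (Hs4 : (s * b < eps)%R).
{ apply (Rmult_lt_compat_r b) in Hs3; [|exact Hb].
  replace (eps / b * b)%R with eps in Hs3 by (field; lra); exact Hs3. }
specialize (HK s (conj Hs0 Hs2)).
assert (M : Cmod (RtoC s) = s) by (rewrite Cmod_R; apply Rabs_pos_eq; lra).
assert (Mi : Cmod (Ci * s) = s) by (rewrite Cmod_mult, M, Cmod_Ci; ring).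
assert (HQ : forall h : C, Cmod h = s ->
  (Cmod (u h) ^ 2 + eps * Cmod (z + h) ^ 2 <= Cmod A ^ 2 + eps * Cmod z ^ 2)%R).
{ intros h Hh; apply HM; [apply Cmod_gt_0|]; lra. }
assert (H1 := HQ (RtoC s) M).
assert (H2 := HQ (- RtoC s) ltac:(now rewrite Cmod_opp)).
assert (H3 := HQ (Ci * s) Mi).
assert (H4 := HQ (- (Ci * s)) ltac:(now rewrite Cmod_opp)).
set (S := u (RtoC s) + u (- RtoC s) + u (Ci * s) + u (- (Ci * s)) - 4 * A) in *.
assert (HRe := Rle_trans _ _ _ (re_le_Cmod (Cconj A * S)) (Req_le _ _ (Cmod_mult _ _))).
rewrite Cmod_conj in HRe.
assert (HRe2 : (- (Cmod A * Rabs K * s ^ 3) <= Re (Cconj A * S))%R).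
{ apply Rabs_le_between in HRe; destruct HRe as [HRe _].
  assert (Hs3p : (0 <= s ^ 3)%R) by (apply pow_le; lra).
  assert (K1 : (Cmod S <= Rabs K * s ^ 3)%R).
  { eapply Rle_trans; [exact HK|]; apply Rmult_le_compat_r; [exact Hs3p|apply Rle_abs]. }
  apply (Rmult_le_compat_l (Cmod A)) in K1; [|apply Cmod_ge_0]; lra. }
assert (HF : (4 * eps * s ^ 2 + 2 * Re (Cconj A * S) <= 0)%R).
{ rewrite !Cmod2_alt in H1, H2, H3, H4.
  unfold S.
  destruct (u (RtoC s)) as [x1 y1], (u (- RtoC s)) as [x2 y2], (u (Ci * s)) as [x3 y3],
    (u (- (Ci * s))) as [x4 y4], A as [a1 a2], z as [z1 z2].
  simpl in *.
  assert (HP : forall x y : R, (0 <= (x - a1) * (x - a1) + (y - a2) * (y - a2))%R).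
  { intros x y; generalize (Rle_0_sqr (x - a1)), (Rle_0_sqr (y - a2)); unfold Rsqr; lra. }
  generalize (HP x1 y1), (HP x2 y2), (HP x3 y3), (HP x4 y4); lra. }
assert (HG : (4 * eps * s ^ 2 <= 2 * (Cmod A * Rabs K) * s ^ 3)%R) by lra.
unfold b in Hs4.
assert (s ^ 2 > 0)%R by (apply pow_lt; exact Hs0).
simpl in HG; nra.
Qed.

Definition punctured_jets (phi : C -> C) : Prop :=
  forall z : C, z <> 0 -> (Cmod z < 1)%R -> exists B D, jet (fun h => phi (z + h)) (phi z) B D.

Lemma square_gap (a e : R) :
  (0 <= a)%R -> (0 < e)%R -> exists t, (0 < t)%R /\ forall y, (0 <= y < a + t)%R -> (y ^ 2 < a ^ 2 + e)%R.
Proof.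
intros Ha He.
set (t := Rmin 1 (e / (2 * a + 1))).
assert (H : (0 < e / (2 * a + 1))%R) by (apply Rdiv_lt_0_compat; lra).
assert (Ht : (0 < t)%R) by (apply Rmin_pos; lra).
assert (Ht1 : (t <= 1)%R) by apply Rmin_l.
assert (Ht2 : (t * (2 * a + 1) <= e)%R).
{ replace e with (e / (2 * a + 1) * (2 * a + 1))%R by (field; lra).
  apply Rmult_le_compat_r; [lra|apply Rmin_r]. }
exists t; split; [exact Ht|]; intros y [Hy1 Hy2].
nra.
Qed.

(** A function tending to 0 at 0 cannot have the maximum of its modulus there,
    unless it vanishes; so the puncture is harmless, and eps -> 0 removes the
    perturbation. *)
Lemma vanishing_max_principle (psi : C -> C) (rho M : R) :
  (0 < rho < 1)%R -> (0 <= M)%R -> punctured_jets psi ->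
  (exists d K, (0 < d)%R /\ forall h : C, h <> 0 -> (Cmod h < d)%R -> (Cmod (psi h) <= K * Cmod h)%R) ->
  (forall z, Cmod z = rho -> (Cmod (psi z) <= M)%R) ->
  forall z : C, z <> 0 -> (Cmod z <= rho)%R -> (Cmod (psi z) <= M)%R.
Proof.
intros Hrho HM HJ H0 Hcirc z Hz Hzr.
assert (Heps : forall eps, (0 < eps)%R -> (Cmod (psi z) ^ 2 <= M ^ 2 + eps * rho ^ 2)%R).
{ intros eps He.
  set (psi0 := fun w : C => if Ceq_dec w 0 then RtoC 0 else psi w).
  set (v := fun w : C => (Cmod (psi0 w) ^ 2 + eps * Cmod w ^ 2)%R).
  assert (Hpsi : forall w : C, w <> 0 -> psi0 w = psi w).
  { intros w Hw; unfold psi0; destruct (Ceq_dec w 0); [contradiction|reflexivity]. }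
  assert (Hpsi0 : psi0 0 = 0) by (unfold psi0; destruct (Ceq_dec 0 0); [reflexivity|contradiction]).
  assert (HC : forall w : C, (Cmod w <= rho)%R -> exists d K : R, (0 < d)%R /\ (0 <= K)%R /\
     forall y : C, (Cmod (y - w) < d)%R -> (Cmod (psi0 y) <= Cmod (psi0 w) + K * Cmod (y - w))%R).
  { intros w Hw; destruct (Ceq_dec w 0) as [->|Hw0].
    - destruct H0 as (d & K & Hd & HK).
      exists d, (Rabs K); split; [exact Hd|split; [apply Rabs_pos|]]; intros y Hy.
      replace (y - 0) with y in * by ring; rewrite Hpsi0, Cmod_0.
      destruct (Ceq_dec y 0) as [->|Hy0].
      + rewrite Hpsi0, Cmod_0; lra.
      + rewrite (Hpsi y Hy0), Rplus_0_l; eapply Rle_trans; [now apply HK|].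
        apply Rmult_le_compat_r; [apply Cmod_ge_0|apply Rle_abs].
    - destruct (HJ w Hw0 ltac:(lra)) as (B & D & J).
      destruct (jet_zeroth_order _ _ _ _ J) as (d & K & Hd & HK0 & HK).
      assert (Hw1 := proj1 (Cmod_gt_0 w) Hw0).
      exists (Rmin d (Cmod w)), K; split; [now apply Rmin_pos|split; [exact HK0|]]; intros y Hy.
      destruct (Ceq_dec (y - w) 0) as [E|E].
      + replace y with (w + (y - w)) by ring; rewrite E.
        replace (w + 0 - w) with (RtoC 0) by ring; rewrite Cplus_0_r, Cmod_0; lra.
      + assert (Y1 := Rlt_le_trans _ _ _ Hy (Rmin_l _ _)).
        assert (Y2 := Rlt_le_trans _ _ _ Hy (Rmin_r _ _)).
        specialize (HK _ E Y1); cbv beta in HK; replace (w + (y - w)) with y in HK by ring.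
        assert (Hy0 : y <> 0).
        { intros ->; replace (0 - w) with (- w) in Y2 by ring; rewrite Cmod_opp in Y2; lra. }
        rewrite !Hpsi by assumption.
        assert (T := Cmod_triangle (psi w) (psi y - psi w)).
        replace (psi w + (psi y - psi w)) with (psi y) in T by ring; lra. }
  destruct (usc_attains_max v rho ltac:(lra)) as (m & Hm & Hmax).
  { intros w Hw e Hepos.
    destruct (HC w Hw) as (d & K & Hd & HK0 & HK).
    destruct (square_gap (Cmod (psi0 w)) (e / 2) (Cmod_ge_0 _) ltac:(lra)) as (t1 & Ht1 & T1).
    destruct (square_gap (Cmod w) (e / (2 * eps)) (Cmod_ge_0 _) ltac:(apply Rdiv_lt_0_compat; lra)) as (t2 & Ht2 & T2).
    assert (Hq : (0 < t1 / (K + 1))%R) by (apply Rdiv_lt_0_compat; lra).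
    exists (Rmin (Rmin d t2) (t1 / (K + 1))); split; [repeat apply Rmin_pos; assumption|].
    intros y _ Hy.
    assert (Y1 := Rlt_le_trans _ _ _ Hy (Rmin_l _ _)).
    assert (Y2 := Rlt_le_trans _ _ _ Hy (Rmin_r _ _)).
    assert (Y3 := Rlt_le_trans _ _ _ Y1 (Rmin_l _ _)).
    assert (Y4 := Rlt_le_trans _ _ _ Y1 (Rmin_r _ _)).
    specialize (HK y Y3).
    apply Rlt_le, (Rmult_le_compat_l (K + 1)) in Y2; [|lra].
    replace ((K + 1) * (t1 / (K + 1)))%R with t1 in Y2 by (field; lra).
    assert (A1 : (Cmod (psi0 y) ^ 2 < Cmod (psi0 w) ^ 2 + e / 2)%R).
    { destruct (Ceq_dec (y - w) 0) as [E|E].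
      - replace y with (w + (y - w)) by ring; rewrite E, Cplus_0_r; lra.
      - assert (E1 := proj1 (Cmod_gt_0 _) E).
        apply T1; split; [apply Cmod_ge_0|lra]. }
    assert (A2 : (Cmod y ^ 2 < Cmod w ^ 2 + e / (2 * eps))%R).
    { apply T2; split; [apply Cmod_ge_0|].
      assert (T := Cmod_triangle w (y - w)).
      replace (w + (y - w)) with y in T by ring; lra. }
    apply (Rmult_lt_compat_l eps) in A2; [|exact He].
    replace (eps * (Cmod w ^ 2 + e / (2 * eps)))%R with (eps * Cmod w ^ 2 + e / 2)%R in A2 by (field; lra).
    unfold v; lra. }
  assert (Hvz := Hmax z Hzr).
  unfold v in Hvz at 1; rewrite (Hpsi z Hz) in Hvz.
  assert (P1 : (0 <= eps * Cmod z ^ 2)%R) by (apply Rmult_le_pos; [lra|apply pow2_ge_0]).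
  assert (P2 : (0 <= eps * rho ^ 2)%R) by (apply Rmult_le_pos; [lra|apply pow2_ge_0]).
  assert (P3 := pow2_ge_0 M).
  destruct (Ceq_dec m 0) as [E|E].
  - subst m; unfold v in Hvz; rewrite Hpsi0, Cmod_0 in Hvz; simpl in *; lra.
  - destruct (Rle_lt_or_eq_dec _ _ Hm) as [L|L].
    + exfalso.
      destruct (HJ m E ltac:(lra)) as (B & D & J).
      assert (E1 := proj1 (Cmod_gt_0 _) E).
      destruct (no_interior_max _ _ _ _ m eps (Rmin (Cmod m) (rho - Cmod m)) J He ltac:(apply Rmin_pos; lra))
        as (h & Hh & Hl & Hgt).
      assert (L1 := Rlt_le_trans _ _ _ Hl (Rmin_l _ _)).
      assert (L2 := Rlt_le_trans _ _ _ Hl (Rmin_r _ _)).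
      assert (Hmh : m + h <> 0).
      { intros E2; assert (E3 : m = - h) by (replace m with (m + h - h) by ring; rewrite E2; ring).
        rewrite E3, Cmod_opp in L1; lra. }
      assert (Hv := Hmax (m + h) ltac:(eapply Rle_trans; [apply Cmod_triangle|lra])).
      unfold v in Hv; rewrite !Hpsi in Hv by assumption; lra.
    + unfold v in Hvz; rewrite (Hpsi m E), L in Hvz.
      assert (Q := pow_incr _ _ 2 (conj (Cmod_ge_0 _) (Hcirc m L))); lra. }
apply Rnot_lt_le; intros Hlt.
assert (Hsq : (M ^ 2 < Cmod (psi z) ^ 2)%R) by nra.
assert (Hr2 : (0 < rho ^ 2)%R) by (apply pow_lt; lra).
specialize (Heps ((Cmod (psi z) ^ 2 - M ^ 2) / (2 * rho ^ 2))%R).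
assert (Hp : (0 < (Cmod (psi z) ^ 2 - M ^ 2) / (2 * rho ^ 2))%R) by (apply Rdiv_lt_0_compat; lra).
specialize (Heps Hp).
replace ((Cmod (psi z) ^ 2 - M ^ 2) / (2 * rho ^ 2) * rho ^ 2)%R with ((Cmod (psi z) ^ 2 - M ^ 2) / 2)%R in Heps
  by (field; lra).
lra.
Qed.

Lemma punctured_jets_mult f g :
  punctured_jets f -> punctured_jets g -> punctured_jets (fun z => f z * g z).
Proof.
intros Hf Hg z Hz Hl.
destruct (Hf z Hz Hl) as (B & D & J), (Hg z Hz Hl) as (B' & D' & J').
eexists _, _; exact (jet_mult _ _ _ _ _ _ _ _ J J').
Qed.

Lemma punctured_jets_plus f g :
  punctured_jets f -> punctured_jets g -> punctured_jets (fun z => f z + g z).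
Proof.
intros Hf Hg z Hz Hl.
destruct (Hf z Hz Hl) as (B & D & J), (Hg z Hz Hl) as (B' & D' & J').
eexists _, _; exact (jet_plus _ _ _ _ _ _ _ _ J J').
Qed.

Lemma punctured_jets_const c : punctured_jets (fun _ => c).
Proof. intros z Hz Hl; eexists _, _; apply jet_const. Qed.

Lemma punctured_jets_id : punctured_jets (fun z => z).
Proof. intros z Hz Hl; eexists _, _; apply jet_translation. Qed.

Lemma punctured_jets_inv (f : C -> C) :
  (forall z : C, z <> 0 -> (Cmod z < 1)%R -> f z <> 0) ->
  punctured_jets f -> punctured_jets (fun z => / f z).
Proof.
intros H0 Hf z Hz Hl.
destruct (Hf z Hz Hl) as (B & D & J).
eexists _, _; exact (jet_inv _ _ _ _ (H0 z Hz Hl) J).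
Qed.

Lemma punctured_jets_pow f n : punctured_jets f -> punctured_jets (fun z => f z ^ n).
Proof.
intros H; induction n as [|n IH]; [exact (punctured_jets_const 1)|].
exact (punctured_jets_mult _ _ H IH).
Qed.

Lemma punctured_jets_reflect f : punctured_jets f -> punctured_jets (fun z => f (- z)).
Proof.
intros H z Hz Hl.
destruct (H (- z)) as (B & D & J).
- intros E; apply Hz; replace z with (- - z) by ring; rewrite E; ring.
- now rewrite Cmod_opp.
- exists (- B), D.
  eapply jet_ext; [|exact (jet_reflect _ _ _ _ J)].
  apply eq_near_0_everywhere; intros h _; f_equal; ring.
Qed.

(** Apply the previous principle to z phi^n, which tends to 0 at 0 as phi is
    bounded: |phi(z)|^n |z| <= M^n for every n, which forbids
    |phi(z)| > M. *)
Lemma punctured_max_principle (phi : C -> C) (rho M : R) :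
  (0 < rho < 1)%R -> (0 <= M)%R -> punctured_jets phi -> bounded_near_0 phi ->
  (forall z, Cmod z = rho -> (Cmod (phi z) <= M)%R) ->
  forall z : C, z <> 0 -> (Cmod z <= rho)%R -> (Cmod (phi z) <= M)%R.
Proof.
intros Hrho HM HJ (d & K & Hd & HK) Hcirc z Hz Hzr.
assert (HP : forall n, (Cmod (phi z) ^ n * Cmod z <= M ^ n)%R).
{ intros n; rewrite <- Cmod_pow, <- Cmod_mult.
  apply (vanishing_max_principle (fun z => phi z ^ n * z) rho (M ^ n)); try assumption.
  - now apply pow_le.
  - exact (punctured_jets_mult _ _ (punctured_jets_pow _ n HJ) punctured_jets_id).
  - exists d, (K ^ n)%R; split; [exact Hd|]; intros h Hh Hl.
    rewrite Cmod_mult, Cmod_pow; apply Rmult_le_compat_r; [apply Cmod_ge_0|].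
    apply pow_incr; split; [apply Cmod_ge_0|now apply HK].
  - intros w Hw; rewrite Cmod_mult, Cmod_pow, Hw.
    assert (Q := pow_incr _ _ n (conj (Cmod_ge_0 _) (Hcirc w Hw))).
    assert (Q2 := pow_le _ n (Cmod_ge_0 (phi w))); nra. }
apply Rnot_lt_le; intros Hlt.
assert (Hz1 := proj1 (Cmod_gt_0 z) Hz).
destruct (Req_dec M 0) as [->|HM0].
- specialize (HP 1%nat); simpl in HP; nra.
- assert (HMp : (0 < M)%R) by lra.
  assert (Hq : (1 < Cmod (phi z) / M)%R).
  { apply (Rmult_lt_reg_r M); [exact HMp|]; replace (Cmod (phi z) / M * M)%R with (Cmod (phi z)) by (field; lra); lra. }
  destruct (Pow_x_infinity (Cmod (phi z) / M) ltac:(rewrite Rabs_pos_eq; lra) (/ Cmod z + 1)) as [N HN].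
  specialize (HN N (le_n N)); specialize (HP N).
  rewrite Rabs_pos_eq in HN by (apply pow_le; lra).
  unfold Rdiv in HN; rewrite Rpow_mult_distr, pow_inv in HN.
  assert (HMN := pow_lt M N HMp).
  assert (Hle : (Cmod (phi z) ^ N * / M ^ N <= / Cmod z)%R).
  { apply (Rmult_le_reg_r (M ^ N * Cmod z)); [now apply Rmult_lt_0_compat|].
    replace (Cmod (phi z) ^ N * / M ^ N * (M ^ N * Cmod z))%R with (Cmod (phi z) ^ N * Cmod z)%R by (field; lra).
    replace (/ Cmod z * (M ^ N * Cmod z))%R with (M ^ N)%R by (field; lra); exact HP. }
  lra.
Qed.

(** Dividing by z^k costs only a factor rho^(-k) on the circle of radius rho,
    and rho may be taken arbitrarily close to 1. *)
Lemma schwarz_lemma (phi : C -> C) (k : nat) :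
  punctured_jets phi -> bounded_near_0 phi ->
  (forall z : C, z <> 0 -> (Cmod z < 1)%R -> (Cmod (phi z) * Cmod z ^ k <= 1)%R) ->
  forall z : C, z <> 0 -> (Cmod z < 1)%R -> (Cmod (phi z) <= 1)%R.
Proof.
intros HJ HB H z Hz Hl.
assert (Hz1 := proj1 (Cmod_gt_0 z) Hz).
assert (Hrho : forall rho, (Cmod z <= rho < 1)%R -> (Cmod (phi z) * rho ^ k <= 1)%R).
{ intros rho Hr.
  assert (Hrk : (0 < rho ^ k)%R) by (apply pow_lt; lra).
  assert (HI : (0 < / rho ^ k)%R) by now apply Rinv_0_lt_compat.
  assert (HQ := punctured_max_principle phi rho (/ rho ^ k) ltac:(lra) ltac:(lra) HJ HB).
  apply (Rmult_le_reg_r (/ rho ^ k)); [exact HI|].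
  rewrite Rmult_assoc, Rinv_r, Rmult_1_r, Rmult_1_l by lra.
  apply HQ; [|exact Hz|lra].
  intros w Hw.
  assert (Hw0 : w <> 0) by (apply Cmod_gt_0; lra).
  assert (Q := H w Hw0 ltac:(lra)); rewrite Hw in Q.
  apply (Rmult_le_reg_r (rho ^ k)); [exact Hrk|]; rewrite Rinv_l by lra; exact Q. }
(* Bernoulli: rho^k is close to 1 when rho is *)
assert (HBern : forall t, (0 <= t <= 1)%R -> (1 - INR k * t <= (1 - t) ^ k)%R).
{ intros t Ht; clear - Ht; induction k as [|k IH]; [simpl; lra|].
  rewrite S_INR; change ((1 - t) ^ S k)%R with ((1 - t) * (1 - t) ^ k)%R.
  generalize (pos_INR k); nra. }
apply Rnot_lt_le; intros Hlt.
set (a := Cmod (phi z)) in *.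
assert (HK := pos_INR k).
set (t := Rmin (1 - Cmod z) ((a - 1) / (2 * a * (INR k + 1)))).
assert (Hq : (0 < (a - 1) / (2 * a * (INR k + 1)))%R) by (apply Rdiv_lt_0_compat; nra).
assert (Ht : (0 < t)%R) by (apply Rmin_pos; lra).
assert (Ht1 : (t <= 1 - Cmod z)%R) by apply Rmin_l.
assert (Ht2 : (2 * a * (INR k + 1) * t <= a - 1)%R).
{ replace (a - 1)%R with (2 * a * (INR k + 1) * ((a - 1) / (2 * a * (INR k + 1))))%R by (field; lra).
  apply Rmult_le_compat_l; [nra|apply Rmin_r]. }
specialize (Hrho (1 - t)%R ltac:(lra)).
specialize (HBern t ltac:(lra)).
assert (HX : (a * (1 - INR k * t) <= 1)%R).
{ eapply Rle_trans; [|exact Hrho]; apply Rmult_le_compat_l; lra. }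
nra.
Qed.

(** * Schwarz-Pick estimates *)

Lemma le_of_le_plus_small (a b K d : R) :
  (0 < d)%R -> (forall t, (0 < t < d)%R -> (a <= b + K * t)%R) -> (a <= b)%R.
Proof.
intros Hd H; apply Rnot_lt_le; intros L.
assert (HK := Rabs_pos K); assert (HK2 := Rle_abs K).
set (e := ((a - b) / (2 * (Rabs K + 1)))%R).
assert (He : (0 < e)%R) by (apply Rdiv_lt_0_compat; lra).
set (t := (Rmin d e / 2)%R).
assert (M0 : (0 < Rmin d e)%R) by now apply Rmin_pos.
assert (M1 := Rmin_l d e); assert (M2 := Rmin_r d e).
specialize (H t ltac:(unfold t; lra)).
assert (T : (t * (2 * (Rabs K + 1)) <= a - b)%R).
{ replace (a - b)%R with (e * (2 * (Rabs K + 1)))%R by (unfold e; field; lra).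
  apply Rmult_le_compat_r; unfold t; lra. }
assert (Ht : (0 < t)%R) by (unfold t; lra).
nra.
Qed.

Lemma moebius_le (a w : C) :
  (Cmod a <= 1)%R -> (Cmod w <= 1)%R -> (Cmod (w - a) <= Cmod (1 - Cconj a * w))%R.
Proof.
intros Ha Hw.
assert (Ha2 := pow_incr _ _ 2 (conj (Cmod_ge_0 a) Ha)).
assert (Hw2 := pow_incr _ _ 2 (conj (Cmod_ge_0 w) Hw)).
apply Rsqr_incr_0_var; [|apply Cmod_ge_0].
rewrite !Rsqr_pow2; rewrite !Cmod2_alt in *.
destruct a as [a1 a2], w as [w1 w2]; simpl in *.
assert (H := Rmult_le_pos (1 - (a1 * a1 + a2 * a2)) (1 - (w1 * w1 + w2 * w2)) ltac:(lra) ltac:(lra)).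
nra.
Qed.

Lemma one_minus_conj_sq (c : C) : (Cmod c <= 1)%R -> Cmod (1 - Cconj c * c) = (1 - Cmod c ^ 2)%R.
Proof.
intros Hc; rewrite Cmult_comm, <- Cmod2_conj, <- RtoC_minus, Cmod_R.
apply Rabs_pos_eq; generalize (pow_incr _ _ 2 (conj (Cmod_ge_0 c) Hc)); lra.
Qed.

(** The Schwarz lemma for (phi - c)/(z^k (1 - conj(c) phi)). The denominator can
    vanish when |c| = 1, so phi and c are first scaled by s < 1, and s tends
    to 1. *)
Lemma schwarz_pick (phi : C -> C) (k : nat) (c : C) :
  punctured_jets phi -> (Cmod c <= 1)%R ->
  (forall z : C, z <> 0 -> (Cmod z < 1)%R -> (Cmod (phi z) <= 1)%R) ->
  bounded_near_0 (fun h => (phi h - c) / h ^ k) ->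
  forall z : C, z <> 0 -> (Cmod z < 1)%R ->
    (Cmod (phi z - c) <= Cmod z ^ k * Cmod (1 - Cconj c * phi z))%R.
Proof.
intros HJ Hc Hphi HB z Hz Hl.
set (X := Cmod (phi z - c)); set (T := (Cmod z ^ k)%R).
assert (HT0 : (0 <= T)%R) by (apply pow_le, Cmod_ge_0).
apply (le_of_le_plus_small X _ (X + 2 * T) 1 Rlt_0_1).
intros t Ht; set (s := (1 - t)%R).
assert (Hs : (0 < s < 1)%R) by (unfold s; lra).
assert (Hs2 : (0 < s * s < 1)%R) by nra.
set (den := fun w : C => 1 - RtoC (s * s) * (Cconj c * phi w)).
assert (Hcp : forall w : C, w <> 0 -> (Cmod w < 1)%R -> (Cmod (Cconj c * phi w) <= 1)%R).
{ intros w Hw Hwl; rewrite Cmod_mult, Cmod_conj.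
  specialize (Hphi w Hw Hwl); generalize (Cmod_ge_0 c), (Cmod_ge_0 (phi w)); nra. }
assert (Hsm : Cmod (RtoC (s * s)) = (s * s)%R) by (rewrite Cmod_R; apply Rabs_pos_eq; lra).
assert (Hden : forall w : C, w <> 0 -> (Cmod w < 1)%R -> (1 - s * s <= Cmod (den w))%R).
{ intros w Hw Hwl; specialize (Hcp w Hw Hwl).
  assert (Q := Cmod_triangle (den w) (RtoC (s * s) * (Cconj c * phi w))).
  replace (den w + RtoC (s * s) * (Cconj c * phi w)) with (RtoC 1) in Q by (unfold den; ring).
  rewrite Cmod_1, (Cmod_mult (RtoC (s * s))), Hsm in Q; nra. }
assert (Hden0 : forall w : C, w <> 0 -> (Cmod w < 1)%R -> den w <> 0).
{ intros w Hw Hwl; apply Cmod_gt_0; generalize (Hden w Hw Hwl); lra. }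
assert (HZk : forall w : C, w <> 0 -> w ^ k <> 0).
{ intros w Hw; apply Cmod_gt_0; rewrite Cmod_pow; apply pow_lt; now apply Cmod_gt_0. }
assert (HS := schwarz_lemma (fun w => RtoC s * ((phi w + - c) * (/ w ^ k * / den w))) k).
assert (HSz : (Cmod (RtoC s * ((phi z + - c) * (/ z ^ k * / den z))) <= 1)%R).
{ apply HS; try assumption.
  - apply punctured_jets_mult; [exact (punctured_jets_const s)|].
    apply punctured_jets_mult; [apply punctured_jets_plus; [exact HJ|exact (punctured_jets_const (- c))]|].
    apply punctured_jets_mult; apply punctured_jets_inv.
    + intros w Hw _; now apply HZk.
    + exact (punctured_jets_pow _ k punctured_jets_id).
    + exact Hden0.
    + apply (punctured_jets_plus (fun _ => 1)); [exact (punctured_jets_const 1)|].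
      intros w Hw Hwl.
      destruct (punctured_jets_mult _ _ (punctured_jets_const (- RtoC (s * s) * Cconj c)) HJ w Hw Hwl) as (B & D & J).
      exists B, D.
      replace (- (RtoC (s * s) * (Cconj c * phi w))) with (- RtoC (s * s) * Cconj c * phi w) by ring.
      eapply jet_ext; [|exact J]; apply eq_near_0_everywhere; intros h _; ring.
  - assert (HD : bounded_near_0 (fun w => / den w)).
    { exists 1%R, (/ (1 - s * s))%R; split; [lra|]; intros w Hw Hwl.
      rewrite Cmod_inv by now apply Hden0.
      apply Rinv_le_contravar; [lra|now apply Hden]. }
    eapply bounded_near_0_ext; [|exact (bounded_near_0_mult _ _ (bounded_near_0_const s) (bounded_near_0_mult _ _ HB HD))].
    exists 1%R; split; [lra|]; intros w Hw Hwl; cbv beta.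
    field; split; first [now apply HZk|now apply Hden0].
  - intros w Hw Hwl.
    assert (Hd := Hden w Hw Hwl).
    rewrite <- Cmod_pow, <- Cmod_mult.
    replace (RtoC s * ((phi w + - c) * (/ w ^ k * / den w)) * w ^ k) with ((s * phi w - s * c) / den w)
      by (field; split; first [now apply HZk|now apply Hden0]).
    rewrite Cmod_div by now apply Hden0.
    apply (Rmult_le_reg_r (Cmod (den w))); [lra|].
    replace (Cmod (s * phi w - s * c) / Cmod (den w) * Cmod (den w))%R with (Cmod (s * phi w - s * c))
      by (field; lra).
    rewrite Rmult_1_l.
    assert (Hsc : forall y : C, (Cmod y <= 1)%R -> (Cmod (s * y) <= 1)%R).
    { intros y Hy; rewrite Cmod_mult, Cmod_R, Rabs_pos_eq by lra; generalize (Cmod_ge_0 y); nra. }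
    eapply Rle_trans; [apply moebius_le; apply Hsc; [exact Hc|now apply Hphi]|].
    apply Req_le; f_equal; unfold den.
    rewrite Cmult_conj, RtoC_mult; unfold Cconj at 1; simpl.
    replace ((s, (- 0)%R) : C) with (RtoC s) by (unfold RtoC; f_equal; ring); ring. }
assert (HTz : Cmod (z ^ k) = T) by (apply Cmod_pow).
assert (HTp : (0 < T)%R) by (rewrite <- HTz; apply Cmod_gt_0; now apply HZk).
assert (HT1 : (T <= 1)%R).
{ unfold T; rewrite <- (pow1 k); apply pow_incr; split; [apply Cmod_ge_0|lra]. }
assert (Hd := Hden z Hz Hl).
assert (HM : (s * X <= T * Cmod (den z))%R).
{ replace (RtoC s * ((phi z + - c) * (/ z ^ k * / den z))) with (s * (phi z - c) / (z ^ k * den z)) in HSz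
    by (field; split; first [now apply HZk|now apply Hden0]).
  rewrite Cmod_div, !Cmod_mult, Cmod_R, Rabs_pos_eq, HTz in HSz; [|lra|].
  - fold X in HSz.
    apply (Rmult_le_compat_r (T * Cmod (den z))) in HSz; [|apply Rmult_le_pos; lra].
    replace (s * X / (T * Cmod (den z)) * (T * Cmod (den z)))%R with (s * X)%R in HSz by (field; lra).
    lra.
  - apply Cmod_gt_0; rewrite Cmod_mult, HTz; apply Rmult_lt_0_compat; lra. }
assert (HY : (Cmod (den z) <= Cmod (1 - Cconj c * phi z) + (1 - s * s))%R).
{ replace (den z) with ((1 - Cconj c * phi z) + RtoC (1 - s * s) * (Cconj c * phi z)).
  - eapply Rle_trans; [apply Cmod_triangle|apply Rplus_le_compat_l].
    rewrite (Cmod_mult (RtoC _)), Cmod_R, Rabs_pos_eq by lra.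
    generalize (Hcp z Hz Hl), (Cmod_ge_0 (Cconj c * phi z)); nra.
  - unfold den; rewrite RtoC_minus; ring. }
unfold s in *.
apply (Rmult_le_compat_l T) in HY; [|exact HT0].
nra.
Qed.

(** If phi = c + ck z^(k+1) + O(z^(k+2)), divide the Schwarz-Pick inequality by
    |z|^(k+1) and let z tend to 0. *)
Lemma leading_coeff_bound (phi : C -> C) (k : nat) (c ck : C) :
  punctured_jets phi -> (Cmod c <= 1)%R ->
  (forall z : C, z <> 0 -> (Cmod z < 1)%R -> (Cmod (phi z) <= 1)%R) ->
  bounded_near_0 (fun h => (phi h - (c + ck * h ^ S k)) / h ^ S (S k)) ->
  (Cmod ck <= 1 - Cmod c ^ 2)%R.
Proof.
intros HJ Hc Hphi HE.
assert (Hk : forall h : C, h <> 0 -> h ^ k <> 0).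
{ intros w Hw; apply Cmod_gt_0; rewrite Cmod_pow; apply pow_lt; now apply Cmod_gt_0. }
assert (HB : bounded_near_0 (fun h => (phi h - c) / h ^ S k)).
{ eapply bounded_near_0_ext; [|exact (bounded_near_0_plus _ _ (bounded_near_0_mult _ _ bounded_near_0_id HE) (bounded_near_0_const ck))].
  apply eq_near_0_everywhere; intros h Hh; simpl; field; split; first [exact Hh|now apply Hk]. }
assert (HSP := schwarz_pick phi (S k) c HJ Hc Hphi HB).
destruct HB as (d1 & K1 & Hd1 & HK1), HE as (d2 & K2 & Hd2 & HK2).
apply (le_of_le_plus_small _ _ (Rabs K1 + K2) (Rmin 1 (Rmin d1 d2))).
{ repeat apply Rmin_pos; lra. }
intros t [Ht Htd].
assert (D0 := Rlt_le_trans _ _ _ Htd (Rmin_l _ _)).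
assert (D3 := Rlt_le_trans _ _ _ Htd (Rmin_r _ _)).
assert (D1 := Rlt_le_trans _ _ _ D3 (Rmin_l _ _)).
assert (D2 := Rlt_le_trans _ _ _ D3 (Rmin_r _ _)).
assert (Mt : Cmod (RtoC t) = t) by (rewrite Cmod_R; apply Rabs_pos_eq; lra).
assert (Ht0 : RtoC t <> 0) by (apply Cmod_gt_0; lra).
specialize (HK1 _ Ht0 ltac:(lra)); specialize (HK2 _ Ht0 ltac:(lra)); specialize (HSP _ Ht0 ltac:(lra)).
set (h := RtoC t) in *.
assert (HSk : h ^ S k <> 0) by (simpl; apply Cmult_neq_0; [exact Ht0|now apply Hk]).
assert (HSkm : (0 < t ^ S k)%R) by now apply pow_lt.
assert (HQ : (Cmod ((phi h - c) / h ^ S k) <= Cmod (1 - Cconj c * phi h))%R).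
{ rewrite Cmod_div, Cmod_pow by exact HSk.
  rewrite Mt in *.
  apply (Rmult_le_reg_r (t ^ S k)); [exact HSkm|].
  replace (Cmod (phi h - c) / t ^ S k * t ^ S k)%R with (Cmod (phi h - c)) by (field; lra); lra. }
assert (HR : (Cmod (1 - Cconj c * phi h) <= 1 - Cmod c ^ 2 + Rabs K1 * t)%R).
{ replace (1 - Cconj c * phi h) with ((1 - Cconj c * c) + - (Cconj c * ((phi h - c) / h ^ S k) * h ^ k * h)).
  - eapply Rle_trans; [apply Cmod_triangle|].
    rewrite one_minus_conj_sq, Cmod_opp by exact Hc; apply Rplus_le_compat_l.
    rewrite !(Cmod_mult (_ * _)), (Cmod_mult (Cconj c)), Cmod_conj, Cmod_pow, Mt.
    apply Rmult_le_compat_r; [lra|].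
    assert (Q1 : (t ^ k <= 1)%R) by (rewrite <- (pow1 k); apply pow_incr; lra).
    assert (Q2 : (0 <= t ^ k)%R) by (apply pow_le; lra).
    assert (Q3 := Rle_abs K1); assert (Q4 := Cmod_ge_0 c).
    assert (Q5 := Cmod_ge_0 ((phi h - c) / h ^ S k)).
    set (y := Cmod ((phi h - c) / h ^ S k)) in *.
    assert (Cmod c * y <= Rabs K1)%R by nra.
    assert (0 <= Cmod c * y)%R by nra.
    nra.
  - simpl; field; split; first [exact Ht0|now apply Hk]. }
replace ck with ((phi h - c) / h ^ S k + - ((phi h - (c + ck * h ^ S k)) / h ^ S (S k) * h))
  by (simpl; field; split; first [exact Ht0|now apply Hk]).
eapply Rle_trans; [apply Cmod_triangle|].
rewrite Cmod_opp, (Cmod_mult _ h), Mt.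
assert (HK2t : (Cmod ((phi h - (c + ck * h ^ S k)) / h ^ S (S k)) * t <= K2 * t)%R)
  by (apply Rmult_le_compat_r; lra).
lra.
Qed.

Lemma bounded_coeff_0 (phi : C -> C) (c0 c1 c2 : C) :
  punctured_jets phi ->
  (forall z : C, z <> 0 -> (Cmod z < 1)%R -> (Cmod (phi z) <= 1)%R) ->
  jet phi c0 c1 c2 -> (Cmod c0 <= 1)%R.
Proof.
intros phi_jets phi_le_1 phi_jet_0.
destruct (jet_zeroth_order _ _ _ _ phi_jet_0) as (d & K & Hd & HK0 & HK).
apply (le_of_le_plus_small _ _ K (Rmin 1 d)); [apply Rmin_pos; lra|].
intros t [Ht Htd].
assert (D0 := Rlt_le_trans _ _ _ Htd (Rmin_l _ _)).
assert (D1 := Rlt_le_trans _ _ _ Htd (Rmin_r _ _)).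
assert (Mt : Cmod (RtoC t) = t) by (rewrite Cmod_R; apply Rabs_pos_eq; lra).
assert (Ht0 : RtoC t <> 0) by (apply Cmod_gt_0; lra).
specialize (HK _ Ht0 ltac:(lra)).
assert (H1 := phi_le_1 _ Ht0 ltac:(lra)).
replace c0 with (phi t + - (phi t - c0)) by ring.
eapply Rle_trans; [apply Cmod_triangle|]; rewrite Cmod_opp, Mt in *; lra.
Qed.

Lemma bounded_coeff_1 (phi : C -> C) (c0 c1 c2 : C) :
  punctured_jets phi ->
  (forall z : C, z <> 0 -> (Cmod z < 1)%R -> (Cmod (phi z) <= 1)%R) ->
  jet phi c0 c1 c2 -> (Cmod c1 <= 1 - Cmod c0 ^ 2)%R.
Proof.
intros phi_jets phi_le_1 phi_jet_0.
apply (leading_coeff_bound phi 0 c0 c1 phi_jets (bounded_coeff_0 _ _ _ _ phi_jets phi_le_1 phi_jet_0) phi_le_1).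
assert (H := phi_jet_0); unfold jet in H.
eapply bounded_near_0_ext; [|exact (bounded_near_0_plus _ _ (bounded_near_0_mult _ _ bounded_near_0_id H) (bounded_near_0_const c2))].
apply eq_near_0_everywhere; intros h Hh; simpl; field; exact Hh.
Qed.

(** The even part (phi(z) + phi(-z))/2 has the same bound and expansion
    c0 + c2 z^2 + O(z^3), to which the bound on leading coefficients
    applies. *)
Lemma bounded_coeff_2 (phi : C -> C) (c0 c1 c2 : C) :
  punctured_jets phi ->
  (forall z : C, z <> 0 -> (Cmod z < 1)%R -> (Cmod (phi z) <= 1)%R) ->
  jet phi c0 c1 c2 -> (Cmod c2 <= 1 - Cmod c0 ^ 2)%R.
Proof.
intros phi_jets phi_le_1 phi_jet_0.
assert (N2 : RtoC 2 <> 0) by (intros E; apply RtoC_inj in E; lra).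
apply (leading_coeff_bound (fun z => / 2 * (phi z + phi (- z))) 1 c0 c2).
- apply (punctured_jets_mult (fun _ => / 2)); [exact (punctured_jets_const (/ 2))|].
  apply punctured_jets_plus; [exact phi_jets|now apply punctured_jets_reflect].
- exact (bounded_coeff_0 _ _ _ _ phi_jets phi_le_1 phi_jet_0).
- intros z Hz Hl.
  assert (Hz' : - z <> 0) by (intros E; apply Hz; replace z with (- - z) by ring; rewrite E; ring).
  assert (T := Cmod_triangle (phi z) (phi (- z))).
  assert (H1 := phi_le_1 z Hz Hl).
  assert (H2 := phi_le_1 (- z) Hz' ltac:(now rewrite Cmod_opp)).
  rewrite Cmod_mult, Cmod_inv, Cmod_R, Rabs_pos_eq by (lra || exact N2); lra.
- assert (H := jet_scal (/ 2) _ _ _ _ (jet_plus _ _ _ _ _ _ _ _ phi_jet_0 (jet_reflect _ _ _ _ phi_jet_0))).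
  eapply bounded_near_0_ext; [|exact H].
  apply eq_near_0_everywhere; intros h Hh; simpl.
  replace (RtoC 2) with (1 + 1) in * by (rewrite <- RtoC_plus; f_equal; ring).
  field; repeat split; assumption.
Qed.

(** Schwarz-Pick gives |phi| <= (x + t)/(1 + x t) with x = |c0| and t = |z|, that
    is 1 - (1 - x)(1 - t)/(1 + x t); replacing 1 + x t by 2 makes the bound
    polynomial in t, easy to integrate along a radius. *)
Lemma bounded_growth (phi : C -> C) (c0 c1 c2 : C) :
  punctured_jets phi ->
  (forall z : C, z <> 0 -> (Cmod z < 1)%R -> (Cmod (phi z) <= 1)%R) ->
  jet phi c0 c1 c2 -> 
  forall z : C, z <> 0 -> (Cmod z < 1)%R ->
    (Cmod (phi z) <= 1 - (1 - Cmod c0) * (1 - Cmod z) / 2)%R.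
Proof.
intros phi_jets phi_le_1 phi_jet_0 z.
intros Hz Hl.
assert (Hc := (bounded_coeff_0 _ _ _ _ phi_jets phi_le_1 phi_jet_0)).
assert (H := schwarz_pick phi 1 c0 phi_jets Hc phi_le_1).
assert (HB : bounded_near_0 (fun h => (phi h - c0) / h ^ 1)).
{ assert (HJ := phi_jet_0); unfold jet in HJ.
  eapply bounded_near_0_ext; [|exact (bounded_near_0_plus _ _ (bounded_near_0_mult _ _ (bounded_near_0_mult _ _ bounded_near_0_id bounded_near_0_id) HJ)
   (bounded_near_0_plus _ _ (bounded_near_0_mult _ _ (bounded_near_0_const c2) bounded_near_0_id) (bounded_near_0_const c1)))].
  apply eq_near_0_everywhere; intros h Hh; simpl; field; exact Hh. }
specialize (H HB z Hz Hl); rewrite pow_1 in H.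
assert (Hy1 := phi_le_1 z Hz Hl).
set (w := phi z) in *; set (t := Cmod z) in *.
assert (Ht : (0 <= t)%R) by apply Cmod_ge_0.
assert (Hp := Rle_trans _ _ _ (Rle_abs _) (Rle_trans _ _ _ (re_le_Cmod (Cconj c0 * w)) (Req_le _ _ (Cmod_mult _ _)))).
rewrite Cmod_conj in Hp.
assert (H2 := pow_incr _ _ 2 (conj (Cmod_ge_0 _) H)).
rewrite Rpow_mult_distr in H2.
assert (E1 : (Cmod (w - c0) ^ 2 = Cmod w ^ 2 + Cmod c0 ^ 2 - 2 * Re (Cconj c0 * w))%R).
{ rewrite !Cmod2_alt; destruct w, c0; simpl; ring. }
assert (E2 : (Cmod (1 - Cconj c0 * w) ^ 2 = 1 + Cmod c0 ^ 2 * Cmod w ^ 2 - 2 * Re (Cconj c0 * w))%R).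
{ rewrite !Cmod2_alt; destruct w, c0; simpl; ring. }
rewrite E1, E2 in H2.
assert (Hx0 := Cmod_ge_0 c0); assert (Hy0 := Cmod_ge_0 w).
set (x := Cmod c0) in *; set (y := Cmod w) in *; set (p := Re (Cconj c0 * w)) in *.
clearbody x y p t.
assert (Ht2 : (0 <= 1 - t ^ 2)%R) by nra.
assert (H3 : ((y - x) ^ 2 <= (t * (1 - x * y)) ^ 2)%R).
{ assert (Q := Rmult_le_compat_l _ _ _ Ht2 Hp); nra. }
assert (Hxy : (0 <= t * (1 - x * y))%R) by (apply Rmult_le_pos; nra).
assert (H4 : (y - x <= t * (1 - x * y))%R).
{ apply Rnot_lt_le; intros L; nra. }
assert (HP : (0 <= (1 - x) * (1 - t))%R) by nra.
assert (Htx : (0 <= t * x <= 1)%R) by nra.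
apply (Rmult_le_reg_l (1 + t * x)); [lra|].
assert (H5 : (0 <= (1 - x) * (1 - t) * (1 - t * x))%R) by nra.
lra.
Qed.

(** * Mean-value inequality and omitted values *)

(** Mean-value inequality along a segment, with a varying bound psi = Psi' for
    the derivative. For d = q(z + v) - q(z), the real function
    Re(conj(d) q(z + s v)) - |d| Psi(s) is nonincreasing on [0, 1], and its
    increment is |d|^2 - |d| (Psi(1) - Psi(0)). *)
Lemma segment_bound (q : C -> C) (z v : C) (Psi psi : R -> R) :
  v <> 0 ->
  (forall s : R, (0 <= s <= 1)%R -> exists A B D : C, A = q (z + s * v) /\
     jet (fun h => q (z + s * v + h)) A B D /\ (Cmod B * Cmod v <= psi s)%R) ->
  (forall s : R, is_derive Psi s (psi s)) ->
  (Cmod (q (z + v) - q z)%C <= Psi 1%R - Psi 0%R)%R.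
Proof.
intros Hv HJ HPsi.
assert (Hv0 := proj1 (Cmod_gt_0 v) Hv).
set (d := q (z + v) - q z).
set (G := fun s : R => Re (Cconj d * q (z + s * v))).
assert (HG : forall s : R, (0 <= s <= 1)%R -> exists l, is_derive G s l /\ (l <= Cmod d * psi s)%R).
{ intros s Hs; destruct (HJ s Hs) as (A & B & D & EA & J & HB); subst A.
  destruct (jet_first_order _ _ _ _ J) as (r & K & Hr & HK).
  exists (Re (Cconj d * (B * v))); split.
  - apply is_derive_Reals; intros e He.
    set (b := (Cmod d * (Rabs K * Cmod v ^ 2) + 1)%R).
    assert (Hb0 : (0 <= Cmod d * (Rabs K * Cmod v ^ 2))%R).
    { apply Rmult_le_pos; [apply Cmod_ge_0|apply Rmult_le_pos; [apply Rabs_pos|apply pow2_ge_0]]. }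
    assert (Hmin : (0 < Rmin (r / Cmod v) (e / b))%R)
      by (apply Rmin_pos; apply Rdiv_lt_0_compat; unfold b; lra).
    exists (mkposreal _ Hmin); intros t Ht Htd; simpl in Htd.
    assert (T1 := Rlt_le_trans _ _ _ Htd (Rmin_l _ _)).
    assert (T2 := Rlt_le_trans _ _ _ Htd (Rmin_r _ _)).
    apply (Rmult_lt_compat_r (Cmod v)) in T1; [|exact Hv0].
    replace (r / Cmod v * Cmod v)%R with r in T1 by (field; lra).
    apply (Rmult_lt_compat_r b) in T2; [|unfold b; lra].
    replace (e / b * b)%R with e in T2 by (field; unfold b; lra).
    assert (Ht0 : RtoC t <> 0) by (intros E; apply RtoC_inj in E; contradiction).
    assert (HKt := HK (t * v) ltac:(now apply Cmult_neq_0) ltac:(now rewrite Cmod_mult, Cmod_R)).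
    cbv beta in HKt.
    replace ((G (s + t)%R - G s) / t - Re (Cconj d * (B * v)))%R with
      (Re (Cconj d * (q (z + s * v + t * v) - q (z + s * v) - B * (t * v)))%C / t)%R.
    2:{ unfold G; rewrite RtoC_plus.
        replace (z + (s + t) * v) with (z + s * v + t * v) by ring.
        destruct (q (z + s * v + t * v)), (q (z + s * v)), B, v, d; simpl; field; exact Ht. }
    unfold Rdiv; rewrite Rabs_mult, Rabs_inv.
    assert (Htp := Rabs_pos_lt t Ht).
    apply (Rmult_lt_reg_r (Rabs t)); [exact Htp|].
    rewrite Rmult_assoc, Rinv_l, Rmult_1_r by lra.
    eapply Rle_lt_trans; [apply re_le_Cmod|].
    rewrite Cmod_mult, Cmod_conj.
    rewrite Cmod_mult, Cmod_R, Rpow_mult_distr in HKt.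
    assert (HKt2 : (Cmod (q (z + s * v + t * v)%C - q (z + s * v)%C - B * (t * v))
       <= Rabs K * (Rabs t ^ 2 * Cmod v ^ 2))%R).
    { eapply Rle_trans; [exact HKt|]; apply Rmult_le_compat_r; [|apply Rle_abs].
      apply Rmult_le_pos; apply pow2_ge_0. }
    apply (Rmult_le_compat_l (Cmod d)) in HKt2; [|apply Cmod_ge_0].
    eapply Rle_lt_trans; [exact HKt2|].
    replace (Cmod d * (Rabs K * (Rabs t ^ 2 * Cmod v ^ 2)))%R with
      (Cmod d * (Rabs K * Cmod v ^ 2) * Rabs t * Rabs t)%R by ring.
    apply Rmult_lt_compat_r; [exact Htp|].
    unfold b in T2; lra.
  - eapply Rle_trans; [apply Rle_abs|]; eapply Rle_trans; [apply re_le_Cmod|].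
    rewrite !Cmod_mult, Cmod_conj.
    apply Rmult_le_compat_l; [apply Cmod_ge_0|exact HB]. }
set (F := fun s => (G s - Cmod d * Psi s)%R).
assert (HF : forall s : R, (0 <= s <= 1)%R -> is_derive F s (Derive F s) /\ (Derive F s <= 0)%R).
{ intros s Hs; destruct (HG s Hs) as (l & Hl & Hle).
  assert (HD : is_derive F s (l - Cmod d * psi s)%R).
  { apply (is_derive_minus G (fun s => Cmod d * Psi s)%R); [exact Hl|].
    exact (is_derive_scal Psi s (Cmod d) (psi s) (HPsi s)). }
  rewrite (is_derive_unique _ _ _ HD); split; [exact HD|lra]. }
destruct (MVT_gen F 0 1 (Derive F)) as (c & Hc & E).
- intros s Hs; rewrite Rmin_left, Rmax_right in Hs by lra; apply HF; lra.
- intros s Hs; rewrite Rmin_left, Rmax_right in Hs by lra.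
  apply continuity_pt_filterlim, (@ex_derive_continuous _ R_NormedModule).
  exists (Derive F s); apply HF; lra.
- rewrite Rmin_left, Rmax_right in Hc by lra.
  destruct (HF c Hc) as [_ Hle].
  destruct (MVT_gen Psi 0 1 psi) as (c' & Hc' & E').
  + intros s _; apply HPsi.
  + intros s _; apply continuity_pt_filterlim, (@ex_derive_continuous _ R_NormedModule).
    exists (psi s); apply HPsi.
  + rewrite Rmin_left, Rmax_right in Hc' by lra.
    destruct (HJ c' Hc') as (A & B & D & _ & _ & HB).
    assert (HB0 := Rmult_le_pos _ _ (Cmod_ge_0 B) (Cmod_ge_0 v)).
    assert (EF : (F 1 - F 0 <= 0)%R) by lra.
    unfold F, G in EF.
    replace (z + 1%R * v) with (z + v) in EF by ring.
    replace (z + 0%R * v) with z in EF by ring.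
    assert (ED : (Re (Cconj d * q (z + v))%C - Re (Cconj d * q z) = Cmod d ^ 2)%R).
    { rewrite Cmod2_alt; unfold d; destruct (q (z + v)), (q z); simpl; ring. }
    assert (Hd := Cmod_ge_0 d).
    assert (Hsq : (Cmod d ^ 2 <= Cmod d * (Psi 1 - Psi 0))%R) by lra.
    apply Rnot_lt_le; intros L; fold d in L.
    assert (HP : (0 < Cmod d * (Cmod d - (Psi 1 - Psi 0)))%R) by (apply Rmult_lt_0_compat; lra).
    simpl in Hsq; lra.
Qed.

(** If |q(0)| > 1 + W then |q| >= m > 1 on the disk, so T(z) = -1/q(z) maps the
    disk into the closed disk of radius r = 1/m and is Lipschitz there with
    constant r^2 < 1. A minimum of |z - T(z)| on that closed disk can only be a
    fixed point of T, where 1 + z q(z) = 0. *)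
Lemma omitted_value_bound (q : C -> C) (W : R) :
  (forall z w : C, (Cmod z < 1)%R -> (Cmod w < 1)%R -> (Cmod (q z - q w) <= Cmod (z - w))%R) ->
  (forall z : C, (Cmod z < 1)%R -> (Cmod (q z - q 0) <= W)%R) ->
  (forall z : C, (Cmod z < 1)%R -> 1 + z * q z <> 0) ->
  (Cmod (q 0) <= 1 + W)%R.
Proof.
intros HL HW HN.
apply Rnot_lt_le; intros Hgt.
set (m := (Cmod (q 0) - W)%R).
assert (Hm : (1 < m)%R) by (unfold m; lra).
assert (Hq : forall z : C, (Cmod z < 1)%R -> (m <= Cmod (q z))%R).
{ intros z Hz; specialize (HW z Hz).
  assert (T := Cmod_triangle (q z) (- (q z - q 0))).
  replace (q z + - (q z - q 0)) with (q 0) in T by ring.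
  rewrite Cmod_opp in T; unfold m; lra. }
assert (Hq0 : forall z : C, (Cmod z < 1)%R -> q z <> 0).
{ intros z Hz; apply Cmod_gt_0; specialize (Hq z Hz); lra. }
set (r := (/ m)%R).
assert (Hr : (0 < r < 1)%R).
{ unfold r; split; [apply Rinv_0_lt_compat; lra|].
  rewrite <- Rinv_1; apply Rinv_lt_contravar; lra. }
assert (Hrr : (0 < r * r < 1)%R) by nra.
set (T := fun z : C => - / q z).
assert (HTr : forall z : C, (Cmod z < 1)%R -> (Cmod (T z) <= r)%R).
{ intros z Hz; unfold T, r; rewrite Cmod_opp, Cmod_inv by now apply Hq0.
  apply Rinv_le_contravar; [lra|now apply Hq]. }
assert (HTL : forall z w : C, (Cmod z < 1)%R -> (Cmod w < 1)%R ->
   (Cmod (T z - T w) <= r * r * Cmod (z - w))%R).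
{ intros z w Hz Hw.
  replace (T z - T w) with (T z * T w * (q z - q w))
    by (unfold T; field; split; now apply Hq0).
  rewrite !Cmod_mult.
  apply Rmult_le_compat; try apply Cmod_ge_0.
  - apply Rmult_le_pos; apply Cmod_ge_0.
  - apply Rmult_le_compat; try apply Cmod_ge_0; now apply HTr.
  - now apply HL. }
destruct (usc_attains_max (fun z => - Cmod (z - T z))%R r) as (z & Hz & Hmax); [lra| |].
{ intros z Hz e He; exists (e / 2)%R; split; [lra|]; intros w Hw Hwz.
  assert (H1 := HTL w z ltac:(lra) ltac:(lra)).
  assert (Hp := Cmod_ge_0 (w - z)).
  assert (H2 : (Cmod (T w - T z) <= Cmod (w - z))%R) by nra.
  assert (Q := Cmod_triangle (w - T w) (T w - T z + - (w - z))).
  assert (Q2 := Cmod_triangle (T w - T z) (- (w - z))).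
  rewrite Cmod_opp in Q2.
  replace (w - T w + (T w - T z + - (w - z))) with (z - T z) in Q by ring.
  lra. }
assert (HTz := HTr z ltac:(lra)).
assert (H1 := Hmax (T z) HTz).
assert (H2 := HTL z (T z) ltac:(lra) ltac:(lra)).
assert (Hp := Cmod_ge_0 (z - T z)).
assert (E : Cmod (z - T z) = 0%R) by nra.
apply Cmod_eq_0 in E.
apply (HN z ltac:(lra)).
assert (E2 : z = T z) by (replace z with (z - T z + T z) at 1 by ring; rewrite E; ring).
rewrite E2 at 1; unfold T; field; apply Hq0; lra.
Qed.

(** * The class U *)

Lemma analytic_pseries_at (f : C -> C) (z0 : C) :
  analytic_on_disk f -> (Cmod z0 < 1)%R ->
  exists (b : nat -> C) (r : R), (0 < r)%R /\
    forall h : C, (Cmod h < r)%R -> c_is_pseries b h (f (z0 + h)).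
Proof.
intros H Hz0; destruct (H z0 Hz0) as (b & r & Hr & Hb).
exists b, r; split; [exact Hr|]; intros h Hh.
specialize (Hb (z0 + h)).
replace (z0 + h - z0) with h in Hb by ring; exact (Hb Hh).
Qed.

Lemma analytic_jet (f : C -> C) (z0 : C) :
  analytic_on_disk f -> (Cmod z0 < 1)%R ->
  exists D, jet (fun h => f (z0 + h)) (f z0) (C_derive f z0) D.
Proof.
intros H Hz0; destruct (analytic_pseries_at f z0 H Hz0) as (b & r & Hr & Hb).
assert (H0 : (Cmod 0 < r)%R) by now rewrite Cmod_0.
assert (E0 := pseries_at_0 _ _ (Hb 0 H0)).
assert (E1 := pseries_at_0 _ _ (pseries_derivative b r f z0 Hb 0 H0)).
rewrite Cplus_0_r in E0, E1.
exists (b 2%nat); rewrite E0, E1; unfold derived.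
apply jet_coeffs with (b 0%nat) (b 1%nat) (b 2%nat); [reflexivity| |reflexivity|].
- simpl; ring.
- apply pseries_jet with r; auto.
Qed.

Lemma analytic_derive (f : C -> C) : analytic_on_disk f -> analytic_on_disk (C_derive f).
Proof.
intros H z0 Hz0; destruct (analytic_pseries_at f z0 H Hz0) as (b & r & Hr & Hb).
exists (derived b), r; split; [exact Hr|]; intros z Hz.
replace (C_derive f z) with (C_derive f (z0 + (z - z0))) by (f_equal; ring).
now apply pseries_derivative with r.
Qed.

Lemma analytic_taylor_series (f : C -> C) :
  analytic_on_disk f -> exists r : R, (0 < r)%R /\
    forall z : C, (Cmod z < r)%R -> c_is_pseries (taylor_coeff f) z (f z).
Proof.
intros H; destruct (analytic_pseries_at f 0 H) as (b & r & Hr & Hb).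
{ rewrite Cmod_0; lra. }
assert (Hb' : forall z : C, (Cmod z < r)%R -> c_is_pseries b z (f z)).
{ intros z Hz; replace (f z) with (f (0 + z)) by (f_equal; ring); now apply Hb. }
exists r; split; [exact Hr|]; intros z Hz.
apply (is_pseries_ext b); [|now apply Hb'].
intros n; symmetry; now apply taylor_coeff_pseries with r.
Qed.

(** The derivative of 1/f - 1/z; membership of f in the class is the bound
    |z^2 omega(z)| < 1. *)
Definition omega (f : C -> C) (z : C) : C := / (z * z) - C_derive f z / (f z * f z).

Lemma omega_jets (f : C -> C) : class_U f -> punctured_jets (omega f).
Proof.
intros ((HA & _) & Hnz & _).
assert (Hf : punctured_jets f).
{ intros z _ Hl; destruct (analytic_jet f z HA Hl) as [D J]; eauto. }
assert (Hf' : punctured_jets (C_derive f)).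
{ intros z _ Hl; destruct (analytic_jet _ z (analytic_derive f HA) Hl) as [D J]; eauto. }
assert (HI : punctured_jets (fun z => / (z * z) + (- (1)) * (C_derive f z * / (f z * f z)))).
{ apply punctured_jets_plus; [|apply punctured_jets_mult; [apply punctured_jets_const|apply punctured_jets_mult; [exact Hf'|]]];
  apply punctured_jets_inv.
  - intros z Hz _; now apply Cmult_neq_0.
  - apply punctured_jets_mult; apply punctured_jets_id.
  - intros z Hz Hl; apply Cmult_neq_0; now apply Hnz.
  - now apply punctured_jets_mult. }
intros z Hz Hl; destruct (HI z Hz Hl) as (B & D & J); exists B, D.
unfold omega.
eapply jet_ext; [|eapply jet_coeffs; [| | |exact J]]; try reflexivity.
- apply eq_near_0_everywhere; intros h _; unfold Cdiv; ring.
- unfold Cdiv; ring.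
Qed.

Lemma omega_class_U_bound (f : C -> C) (z : C) :
  class_U f -> z <> 0 -> (Cmod z < 1)%R -> (Cmod (omega f z) * Cmod z ^ 2 <= 1)%R.
Proof.
intros (_ & Hnz & Hlt) Hz Hl.
specialize (Hlt z Hl); specialize (Hnz z Hl Hz).
unfold z_over in Hlt; destruct (Ceq_dec z 0) as [E|_]; [contradiction|].
rewrite <- Cmod_pow, <- Cmod_mult, <- Cmod_opp.
replace (- (omega f z * z ^ 2)) with ((z / f z) ^ 2 * C_derive f z - 1); [lra|].
unfold omega; field; split; assumption.
Qed.

(** The first three coefficients of omega at 0, in terms of the Taylor
    coefficients a of f. *)
Definition omega_coeff_0 (a : nat -> C) : C := a 2%nat ^ 2 - a 3%nat.
Definition omega_coeff_1 (a : nat -> C) : C := 4 * a 2%nat * a 3%nat - 2 * a 4%nat - 2 * a 2%nat ^ 3.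
Definition omega_coeff_2 (a : nat -> C) : C :=
  3 * a 3%nat ^ 2 + 6 * a 2%nat * a 4%nat - 3 * a 5%nat - 9 * a 2%nat ^ 2 * a 3%nat + 3 * a 2%nat ^ 4.

Lemma RtoC_INR_S (n : nat) : RtoC (INR (S n)) = RtoC (INR n) + 1.
Proof. now rewrite S_INR, RtoC_plus. Qed.

Lemma RtoC_2 : RtoC 2 = 1 + 1.
Proof. rewrite <- RtoC_plus; f_equal; ring. Qed.

Lemma RtoC_3 : RtoC 3 = 1 + 1 + 1.
Proof. rewrite <- !RtoC_plus; f_equal; ring. Qed.

Lemma RtoC_4 : RtoC 4 = 1 + 1 + 1 + 1.
Proof. rewrite <- !RtoC_plus; f_equal; ring. Qed.

Lemma RtoC_6 : RtoC 6 = (1 + 1) * (1 + 1 + 1).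
Proof. rewrite <- !RtoC_plus, <- RtoC_mult; f_equal; ring. Qed.

Lemma RtoC_9 : RtoC 9 = (1 + 1 + 1) * (1 + 1 + 1).
Proof. rewrite <- !RtoC_plus, <- RtoC_mult; f_equal; ring. Qed.

(** Writing f = h + a2 h^2 + h^3 P and f' = 1 + 2 a2 h + h^2 Q, with P and Q
    expanded to second order, the powers of h cancel:
    omega = (a2^2 + 2 P + 2 a2 h P + (h P)^2 - Q)/p^2 and
    1/f - 1/h = -(a2 + h P)/p, where p = f/h = 1 + a2 h + h^2 P. *)
Lemma class_U_expansions (f : C -> C) (a := taylor_coeff f) :
  class_U f ->
  jet (omega f) (omega_coeff_0 a) (omega_coeff_1 a) (omega_coeff_2 a) /\ exists D, jet (fun z => / f z - / z) (- a 2%nat) (omega_coeff_0 a) D.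
Proof.
intros ((HA & Ha0 & Ha1) & Hnz & _).
destruct (analytic_taylor_series f HA) as (r & Hr & Hs).
fold a in Ha0, Ha1, Hs.
set (P := fun h => (((f h - a 0%nat) / h - a 1%nat) / h - a 2%nat) / h).
assert (JP : jet P (a 3%nat) (a 4%nat) (a 5%nat)).
{ apply (pseries_jet (fun n => a (S (S (S n)))) r P Hr); intros h Hh Hl.
  apply (pseries_shift (fun n => a (S (S n)))); [exact Hh|].
  apply (pseries_shift (fun n => a (S n))); [exact Hh|].
  apply (pseries_shift a); [exact Hh|now apply Hs]. }
set (Q := fun h => ((C_derive f h - derived a 0) / h - derived a 1) / h).
assert (JQ : jet Q (derived a 2) (derived a 3) (derived a 4)).
{ apply (pseries_jet (fun n => derived a (S (S n))) r Q Hr); intros h Hh Hl.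
  apply (pseries_shift (fun n => derived a (S n))); [exact Hh|].
  apply (pseries_shift (derived a)); [exact Hh|].
  replace (C_derive f h) with (C_derive f (0 + h)) by (f_equal; ring).
  apply pseries_derivative with r; [|exact Hl].
  intros w Hw; replace (f (0 + w)) with (f w) by (f_equal; ring); now apply Hs. }
assert (Jh : jet (fun h => h) 0 1 0).
{ eapply jet_ext; [|exact (jet_translation 0)]; apply eq_near_0_everywhere; intros; ring. }
assert (JhP := jet_mult _ _ _ _ _ _ _ _ Jh JP).
(* the expansion of p = f(h)/h *)
assert (Jp := jet_plus _ _ _ _ _ _ _ _ (jet_const 1)
   (jet_mult _ _ _ _ _ _ _ _ Jh (jet_plus _ _ _ _ _ _ _ _ (jet_const (a 2%nat)) JhP))).
assert (N1 : 1 + 0 * (a 2%nat + 0 * a 3%nat) <> 0).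
{ replace (1 + 0 * (a 2%nat + 0 * a 3%nat)) with (RtoC 1) by ring; intros E; apply RtoC_inj in E; lra. }
assert (Jip := jet_inv _ _ _ _ N1 Jp).
assert (Hfp : forall h : C, h <> 0 -> 1 + h * (a 2%nat + h * P h) = f h / h).
{ intros h Hh; unfold P; rewrite Ha0, Ha1; field; exact Hh. }
split.
- assert (JN := jet_plus _ _ _ _ _ _ _ _ (jet_const (a 2%nat ^ 2))
    (jet_plus _ _ _ _ _ _ _ _ (jet_scal 2 _ _ _ _ JP)
    (jet_plus _ _ _ _ _ _ _ _ (jet_scal (2 * a 2%nat) _ _ _ _ JhP)
    (jet_plus _ _ _ _ _ _ _ _ (jet_mult _ _ _ _ _ _ _ _ JhP JhP) (jet_scal (- (1)) _ _ _ _ JQ))))).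
  assert (J := jet_mult _ _ _ _ _ _ _ _ JN (jet_mult _ _ _ _ _ _ _ _ Jip Jip)).
  eapply jet_ext; [|eapply jet_coeffs; [| | |exact J]].
  + exists 1%R; split; [lra|]; intros h Hh Hl.
    assert (Hfh := Hnz h Hl Hh).
    cbv beta; rewrite Hfp by exact Hh.
    unfold omega.
    assert (EQ : C_derive f h = 1 + 2 * a 2%nat * h + h * h * Q h).
    { unfold Q, derived; rewrite Ha1; simpl.
      replace (RtoC (1 + 1)) with (RtoC 2) by (f_equal; ring); field; exact Hh. }
    assert (EF : h * h * (a 2%nat + h * P h) = f h - h) by (unfold P; rewrite Ha0, Ha1; field; exact Hh).
    rewrite EQ.
    transitivity (((f h / h) ^ 2 - (1 + 2 * a 2%nat * h + h * h * Q h)) / (h * h) * (/ (f h / h) * / (f h / h))).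
    * f_equal.
      rewrite <- Hfp by exact Hh; rewrite RtoC_2; field; exact Hh.
    * field; split; assumption.
  + unfold omega_coeff_0, derived; rewrite !RtoC_INR_S, RtoC_2; simpl INR; field; exact N1.
  + unfold omega_coeff_1, derived; rewrite !RtoC_INR_S, RtoC_4, RtoC_2; simpl INR; field; exact N1.
  + unfold omega_coeff_2, derived; rewrite !RtoC_INR_S, RtoC_9, RtoC_6, RtoC_3, RtoC_2; simpl INR; field; exact N1.
- assert (J := jet_mult _ _ _ _ _ _ _ _ (jet_scal (- (1)) _ _ _ _ (jet_plus _ _ _ _ _ _ _ _ (jet_const (a 2%nat)) JhP)) Jip).
  eexists.
  eapply jet_ext; [|eapply jet_coeffs; [| | |exact J]].
  + exists 1%R; split; [lra|]; intros h Hh Hl.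
    assert (Hfh := Hnz h Hl Hh).
    cbv beta; rewrite Hfp by exact Hh.
    unfold P; rewrite Ha0, Ha1; field; split; assumption.
  + field; exact N1.
  + unfold omega_coeff_0; field; exact N1.
  + reflexivity.
Qed.

Lemma omega_le_1 (f : C -> C) :
  class_U f -> forall z : C, z <> 0 -> (Cmod z < 1)%R -> (Cmod (omega f z) <= 1)%R.
Proof.
intros HU; apply (schwarz_lemma (omega f) 2).
- now apply omega_jets.
- eapply jet_bounded; exact (proj1 (class_U_expansions f HU)).
- intros z Hz Hl; now apply omega_class_U_bound.
Qed.

(** The function q = 1/f - 1/z, extended by q(0) = -a2, has derivative omega, so
    it is 1-Lipschitz and, integrating the growth bound of omega along a radius,
    satisfies |q - q(0)| <= 1 - (1 - x)/4 with x = |a2^2 - a3|. Since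
    1 + z q(z) = z/f(z) has no zero, the bound on omitted values applies. *)
Lemma class_U_second_coeff (f : C -> C) (a := taylor_coeff f) :
  class_U f -> (Cmod (a 2%nat) <= 2 - (1 - Cmod (omega_coeff_0 a)) / 4)%R.
Proof.
intros HU.
assert (Hle := omega_le_1 f HU).
destruct (class_U_expansions f HU) as [Jw [D0 J0]].
fold a in Jw, J0.
assert (HJ := omega_jets f HU).
assert (Hx := bounded_coeff_0 _ _ _ _ HJ Hle Jw).
assert (Hgrowth := bounded_growth _ _ _ _ HJ Hle Jw).
destruct HU as ((HA & _) & Hnz & _).
set (x := Cmod (omega_coeff_0 a)) in *.
assert (Hx0 : (0 <= x)%R) by apply Cmod_ge_0.
set (q := fun z : C => if Ceq_dec z 0 then - a 2%nat else / f z - / z).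
assert (q0 : q 0 = - a 2%nat) by (unfold q; destruct (Ceq_dec 0 0); [reflexivity|contradiction]).
assert (qz : forall z : C, z <> 0 -> q z = / f z - / z).
{ intros z Hz; unfold q; destruct (Ceq_dec z 0); [contradiction|reflexivity]. }
assert (Hq : forall z : C, (Cmod z < 1)%R -> exists B D : C,
  jet (fun h => q (z + h)) (q z) B D /\ (Cmod B <= 1 - (1 - x) * (1 - Cmod z) / 2)%R).
{ intros z Hl; destruct (Ceq_dec z 0) as [->|Hz].
  - exists (omega_coeff_0 a), D0; split.
    + rewrite q0; eapply jet_ext; [|exact J0].
      apply eq_near_0_everywhere; intros h Hh; rewrite Cplus_0_l; now rewrite qz.
    + fold x; rewrite Cmod_0; lra.
  - destruct (analytic_jet f z HA Hl) as [D Jf].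
    assert (Jz := jet_translation z).
    assert (J := jet_plus _ _ _ _ _ _ _ _ (jet_inv _ _ _ _ (Hnz z Hl Hz) Jf)
                  (jet_scal (- (1)) _ _ _ _ (jet_inv _ _ _ _ Hz Jz))).
    exists (omega f z); eexists; split; [|now apply Hgrowth].
    eapply jet_ext; [|eapply jet_coeffs; [| | |exact J]].
    + exists (Cmod z); split; [now apply Cmod_gt_0|]; intros h Hh Hhl.
      rewrite qz; [unfold Cminus; ring|].
      intros E; assert (Eh : z = - h) by (replace z with (z + h - h) by ring; rewrite E; ring).
      rewrite Eh, Cmod_opp in Hhl; lra.
    + rewrite qz by exact Hz; ring.
    + unfold omega; field; split; [now apply Hnz|exact Hz].
    + reflexivity. }
replace (2 - (1 - x) / 4)%R with (1 + (1 - (1 - x) / 4))%R by ring.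
rewrite <- (Cmod_opp (a 2%nat)), <- q0.
apply omitted_value_bound.
- intros z w Hz Hw.
  destruct (Ceq_dec (z - w) 0) as [E|E].
  { replace z with (z - w + w) at 1 by ring; rewrite E, Cplus_0_l.
    replace (q w - q w) with (RtoC 0) by ring; rewrite Cmod_0; lra. }
  replace (q z) with (q (w + (z - w))) by (f_equal; ring).
  replace (Cmod (z - w)) with (Cmod (z - w) * 1 - Cmod (z - w) * 0)%R by ring.
  apply (segment_bound q w (z - w) (fun s => Cmod (z - w) * s)%R (fun _ => Cmod (z - w))); [exact E| |].
  + intros s Hs.
    assert (Hl : (Cmod (w + s * (z - w)) < 1)%R).
    { replace (w + s * (z - w)) with (RtoC (1 - s) * w + s * z) by (rewrite RtoC_minus; ring).
      eapply Rle_lt_trans; [apply Cmod_triangle|].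
      rewrite !Cmod_mult, !Cmod_R, !Rabs_pos_eq by lra.
      destruct (Req_dec s 0) as [->|]; nra. }
    destruct (Hq _ Hl) as (B & D & J & HB).
    exists (q (w + s * (z - w))), B, D; split; [reflexivity|split; [exact J|]].
    assert (Hd := Cmod_ge_0 (z - w)).
    assert (HB1 : (Cmod B <= 1)%R) by nra.
    nra.
  + intros s; auto_derive; [exact I|ring].
- intros z Hz.
  destruct (Ceq_dec z 0) as [->|Hz0].
  { replace (q 0 - q 0) with (RtoC 0) by ring; rewrite Cmod_0; lra. }
  set (t := Cmod z) in *.
  assert (Ht : (0 <= t)%R) by apply Cmod_ge_0.
  set (Psi := fun s : R => (t * s - (1 - x) / 2 * (t * s - t ^ 2 * s ^ 2 / 2))%R).
  assert (HS : (Cmod (q (0 + z) - q 0)%C <= Psi 1 - Psi 0)%R).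
  { apply (segment_bound q 0 z Psi (fun s => t * (1 - (1 - x) * (1 - t * s) / 2))%R); [exact Hz0| |].
    - intros s Hs.
      assert (Ms : Cmod (0 + s * z) = (t * s)%R).
      { rewrite Cplus_0_l, Cmod_mult, Cmod_R, Rabs_pos_eq by lra; apply Rmult_comm. }
      destruct (Hq (0 + s * z)) as (B & D & J & HB); [rewrite Ms; nra|].
      exists (q (0 + s * z)), B, D; split; [reflexivity|split; [exact J|]].
      rewrite Ms in HB; fold t; rewrite Rmult_comm; apply Rmult_le_compat_l; assumption.
    - intros s; unfold Psi; auto_derive; [exact I|field]. }
  rewrite Cplus_0_l in HS.
  eapply Rle_trans; [exact HS|]; unfold Psi.
  assert (H1 : (0 <= (1 - t) * (1 - (1 - x) * (1 - t) / 4))%R) by (apply Rmult_le_pos; nra).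
  lra.
- intros z Hl E.
  destruct (Ceq_dec z 0) as [->|Hz].
  + apply (f_equal (fun w => w + - (0 * q 0))) in E.
    assert (E1 : RtoC 1 = 0) by (transitivity (1 + 0 * q 0 + - (0 * q 0)); [ring|rewrite E; ring]).
    apply RtoC_inj in E1; lra.
  + rewrite qz in E by exact Hz.
    apply Hz.
    assert (Hf := Hnz z Hl Hz).
    transitivity ((1 + z * (/ f z - / z)) * f z); [field; split; assumption|rewrite E; ring].
Qed.

(** With x = |c0| and B = 2 - (1 - x)/4, the triangle inequality bounds
    |a3^2 - a5| by B^2 x + (B + 1/3)(1 - x^2), which is
    4 - (1 - x)(92 - 67 x - 9 x^2)/48 and therefore at most 4 on [0, 1]. *)
Lemma class_U_coeff_bounds (f : C -> C) (a := taylor_coeff f) :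
  class_U f ->
  (Cmod (a 2%nat ^ 2 - a 3%nat) <= 1)%R /\ (Cmod (a 3%nat ^ 2 - a 5%nat) <= 4)%R.
Proof.
intros HU.
assert (HJ := omega_jets f HU).
assert (Hle := omega_le_1 f HU).
assert (J := proj1 (class_U_expansions f HU)); fold a in J.
assert (H0 := bounded_coeff_0 _ _ _ _ HJ Hle J).
assert (H1 := bounded_coeff_1 _ _ _ _ HJ Hle J).
assert (H2 := bounded_coeff_2 _ _ _ _ HJ Hle J).
assert (HA := class_U_second_coeff f HU); fold a in HA.
split; [exact H0|].
replace (a 3%nat ^ 2 - a 5%nat) with (a 2%nat ^ 2 * omega_coeff_0 a + a 2%nat * omega_coeff_1 a + / 3 * omega_coeff_2 a).
2:{ assert (N3 : RtoC 3 <> 0) by (intros E; apply RtoC_inj in E; lra).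
    unfold omega_coeff_0, omega_coeff_1, omega_coeff_2.
    rewrite RtoC_9, RtoC_6, RtoC_4, RtoC_2, RtoC_3 in *; field; exact N3. }
assert (M3 : Cmod (/ 3) = (/ 3)%R).
{ rewrite Cmod_inv, Cmod_R, Rabs_pos_eq; [reflexivity|lra|intros E; apply RtoC_inj in E; lra]. }
eapply Rle_trans; [apply Cmod_triangle|].
eapply Rle_trans; [apply Rplus_le_compat_r, Cmod_triangle|].
rewrite !Cmod_mult, Cmod_pow, M3.
assert (P0 := Cmod_ge_0 (omega_coeff_0 a)); assert (P1 := Cmod_ge_0 (omega_coeff_1 a)); assert (P := Cmod_ge_0 (a 2%nat)).
set (x := Cmod (omega_coeff_0 a)) in *; set (A := Cmod (a 2%nat)) in *.
set (y1 := Cmod (omega_coeff_1 a)) in *; set (y2 := Cmod (omega_coeff_2 a)) in *.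
clearbody x A y1 y2.
set (B := (2 - (1 - x) / 4)%R) in *.
assert (Q1 : (A ^ 2 * x <= B ^ 2 * x)%R) by (apply Rmult_le_compat_r; [exact P0|apply pow_incr; split; assumption]).
assert (Q2 : (A * y1 <= B * (1 - x ^ 2))%R) by (apply Rmult_le_compat; assumption).
assert (Q3 : (B ^ 2 * x + B * (1 - x ^ 2) + / 3 * (1 - x ^ 2) <= 4)%R).
{ assert (H : (0 <= (1 - x) * (92 - 67 * x - 9 * x ^ 2))%R) by (apply Rmult_le_pos; nra).
  unfold B; lra. }
lra.
Qed.

(** * The Koebe function and its rotations *)

Lemma C_derive_jet (f : C -> C) (z A B D : C) :
  A = f z -> jet (fun h => f (z + h)) A B D -> C_derive f z = B.
Proof.
intros -> J; apply C_derive_of_quadratic_error.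
destruct (jet_first_order _ _ _ _ J) as (d & K & Hd & HK).
exists d, K; split; [exact Hd|exact HK].
Qed.

Lemma geometric_pseries (a h : C) :
  (Cmod h < Cmod a)%R -> c_is_pseries (fun n => / a ^ S n) h (/ (a - h)).
Proof.
intros Hl; apply c_is_pseries_eps; intros e He.
assert (Hh := Cmod_ge_0 h).
assert (Ha : a <> 0) by (apply Cmod_gt_0; lra).
assert (Hap : forall n, a ^ n <> 0).
{ intros n; apply Cmod_gt_0; rewrite Cmod_pow; apply pow_lt; lra. }
assert (Hah : a - h <> 0).
{ intros E; assert (E2 : a = h) by (replace a with (a - h + h) by ring; rewrite E; ring).
  rewrite E2 in Hl; lra. }
assert (HS : forall n, partial_sum (fun n => / a ^ S n) h n - / (a - h) = - (h / a) ^ S n * / (a - h)).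
{ induction n as [|n IH].
  - rewrite partial_sum_0; simpl; field; split; assumption.
  - rewrite partial_sum_S.
    replace (partial_sum (fun n0 : nat => / a ^ S n0) h n + / a ^ S (S n) * h ^ S n - / (a - h))
      with (partial_sum (fun n0 : nat => / a ^ S n0) h n - / (a - h) + / a ^ S (S n) * h ^ S n) by ring.
    rewrite IH; unfold Cdiv; rewrite !Cpow_mult_l, !Cpow_inv by exact Ha.
    simpl; field; repeat split; try assumption; apply Hap. }
assert (Hm := proj1 (Cmod_gt_0 _) Hah).
assert (Hq : (0 <= Cmod (h / a) < 1)%R).
{ split; [apply Cmod_ge_0|]; rewrite Cmod_div by exact Ha.
  apply (Rmult_lt_reg_r (Cmod a)); [lra|]; unfold Rdiv; rewrite Rmult_assoc, Rinv_l; lra. }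
destruct (pow_lt_1_zero (Cmod (h / a)) ltac:(rewrite Rabs_pos_eq; lra) (e * Cmod (a - h))) as [N HN];
  [now apply Rmult_lt_0_compat|].
exists N; intros n Hn; rewrite HS.
specialize (HN (S n) ltac:(lia)); rewrite Rabs_pos_eq in HN by (apply pow_le; lra).
rewrite Cmod_mult, Cmod_opp, Cmod_pow, Cmod_inv by exact Hah.
apply (Rmult_lt_reg_r (Cmod (a - h))); [exact Hm|].
rewrite Rmult_assoc, Rinv_l by lra; lra.
Qed.

Lemma one_minus_neq_0 (z : C) : (Cmod z < 1)%R -> 1 - z <> 0.
Proof.
intros Hz E; assert (E2 : z = 1) by (replace z with (1 - (1 - z)) by ring; rewrite E; ring).
rewrite E2, Cmod_1 in Hz; lra.
Qed.

(** Differentiate the geometric series of g(z) = 1/(1 - z) about z0 and use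
    k = g' - g. *)
Lemma koebe_pseries (z0 h : C) :
  (Cmod z0 < 1)%R -> (Cmod h < 1 - Cmod z0)%R ->
  c_is_pseries (fun n => derived (fun k => / (1 - z0) ^ S k) n - / (1 - z0) ^ S n) h (koebe (z0 + h)).
Proof.
intros Hz0 Hh.
set (g := fun z : C => / (1 - z)).
assert (Ha : (1 - Cmod z0 <= Cmod (1 - z0))%R).
{ assert (T := Cmod_triangle (1 - z0) z0).
  replace (1 - z0 + z0) with (RtoC 1) in T by ring; rewrite Cmod_1 in T; lra. }
assert (Hg : forall k : C, (Cmod k < 1 - Cmod z0)%R -> c_is_pseries (fun n => / (1 - z0) ^ S n) k (g (z0 + k))).
{ intros k Hk; unfold g; replace (1 - (z0 + k)) with (1 - z0 - k) by ring.
  apply geometric_pseries; lra. }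
assert (Hz : 1 - (z0 + h) <> 0).
{ apply one_minus_neq_0; eapply Rle_lt_trans; [apply Cmod_triangle|lra]. }
assert (HD := pseries_derivative _ _ g z0 Hg h Hh).
assert (Eg : C_derive g (z0 + h) = / (1 - (z0 + h)) ^ 2).
{ set (z := z0 + h) in *.
  assert (Hz' : 1 + - (1) * z <> 0) by (replace (1 + - (1) * z) with (1 - z) by ring; exact Hz).
  assert (J := jet_inv _ _ _ _ Hz' (jet_plus _ _ _ _ _ _ _ _ (jet_const 1) (jet_scal (- (1)) _ _ _ _ (jet_translation z)))).
  rewrite (C_derive_jet g z (/ (1 + - (1) * z)) (- ((0 + - (1) * 1) / (1 + - (1) * z) ^ 2))
     ((0 + - (1) * 1) ^ 2 / (1 + - (1) * z) ^ 3 - (0 + - (1) * 0) / (1 + - (1) * z) ^ 2)).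
  - field; repeat split; assumption.
  - unfold g; f_equal; ring.
  - eapply jet_ext; [|exact J]; apply eq_near_0_everywhere; intros k _; unfold g; f_equal; ring. }
rewrite Eg in HD.
assert (HM := is_pseries_minus (K := C_AbsRing) (V := C_NormedModule) _ _ _ _ _ HD (Hg h Hh)).
unfold c_is_pseries; replace (koebe (z0 + h)) with (/ (1 - (z0 + h)) ^ 2 - g (z0 + h)).
- exact HM.
- unfold koebe, g; field; exact Hz.
Qed.

Lemma koebe_taylor_series (z : C) :
  (Cmod z < 1)%R -> c_is_pseries (fun n => RtoC (INR n)) z (koebe z).
Proof.
intros Hz; replace z with (0 + z) at 2 by ring.
eapply (@is_pseries_ext C_AbsRing C_NormedModule); [|apply koebe_pseries; rewrite Cmod_0; lra].
intros n.
assert (E : forall k, (1 - 0) ^ k = 1).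
{ intros k; replace (1 - 0) with (RtoC 1) by ring; apply Cpow_1_l. }
assert (En : INR (S n) * / (1 - 0) ^ S (S n) - / (1 - 0) ^ S n = INR n).
{ rewrite !E, RtoC_INR_S; field. }
exact En.
Qed.

Lemma koebe_taylor_coeff n : taylor_coeff koebe n = RtoC (INR n).
Proof.
exact (taylor_coeff_pseries _ 1%R koebe n Rlt_0_1 koebe_taylor_series).
Qed.

Lemma koebe_class_U : class_U koebe.
Proof.
split; [split; [|split]|split].
- intros z0 Hz0; eexists _, (1 - Cmod z0)%R; split; [lra|]; intros z Hz.
  replace (koebe z) with (koebe (z0 + (z - z0))) by (f_equal; ring).
  now apply koebe_pseries.
- rewrite koebe_taylor_coeff; reflexivity.
- rewrite koebe_taylor_coeff; reflexivity.
- intros z Hl Hz; assert (H := one_minus_neq_0 z Hl).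
  intros E; apply Hz.
  transitivity (koebe z * (1 - z) ^ 2); [unfold koebe; field; exact H|rewrite E; ring].
- intros z Hl; assert (H := one_minus_neq_0 z Hl).
  assert (Hk : C_derive koebe z = (1 + z) / (1 - z) ^ 3).
  { assert (H' : (1 + - (1) * z) * (1 + - (1) * z) <> 0).
    { replace (1 + - (1) * z) with (1 - z) by ring; now apply Cmult_neq_0. }
    assert (J1 := jet_plus _ _ _ _ _ _ _ _ (jet_const 1) (jet_scal (- (1)) _ _ _ _ (jet_translation z))).
    assert (J := jet_mult _ _ _ _ _ _ _ _ (jet_translation z) (jet_inv _ _ _ _ H' (jet_mult _ _ _ _ _ _ _ _ J1 J1))).
    erewrite (C_derive_jet koebe z); [| |eapply jet_ext; [|exact J]].
    - field; exact H.
    - unfold koebe, Cdiv; f_equal; f_equal; ring.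
    - apply eq_near_0_everywhere; intros h _; unfold koebe, Cdiv; f_equal; f_equal; ring. }
  assert (HE : z_over koebe z ^ 2 * C_derive koebe z - 1 = - z ^ 2).
  { rewrite Hk; unfold z_over; destruct (Ceq_dec z 0) as [->|Hz].
    - field; intros E; apply RtoC_inj in E; lra.
    - unfold koebe; field; split; assumption. }
  rewrite HE, Cmod_opp, Cmod_pow.
  generalize (Cmod_ge_0 z); simpl; nra.
Qed.

Lemma cis_mult_opp theta : cis (- theta) * cis theta = 1.
Proof.
unfold cis; rewrite cos_neg, sin_neg; unfold Cmult, RtoC; simpl; f_equal; [|ring].
generalize (sin2_cos2 theta); unfold Rsqr; lra.
Qed.

Lemma Cmod_cis theta : Cmod (cis theta) = 1%R.
Proof.
unfold Cmod, cis; simpl.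
match goal with |- sqrt ?x = _ => replace x with 1%R; [apply sqrt_1|] end.
generalize (sin2_cos2 theta); unfold Rsqr; lra.
Qed.

Lemma rotation_pseries (b : nat -> C) (f : C -> C) (theta : R) (z0 h : C) :
  c_is_pseries b (cis theta * h) (f (cis theta * z0 + cis theta * h)) ->
  c_is_pseries (fun n => cis (- theta) * (b n * cis theta ^ n)) h (rotation f theta (z0 + h)).
Proof.
intros H.
unfold c_is_pseries, rotation.
replace (cis theta * (z0 + h)) with (cis theta * z0 + cis theta * h) by ring.
apply (is_pseries_scal (K := C_AbsRing) (V := C_NormedModule) (cis (- theta)) (fun n => b n * cis theta ^ n)).
{ apply Cmult_comm. }
refine (is_series_ext _ _ _ _ H).
intros n; rewrite !pow_n_Cpow.
change ((cis theta * h) ^ n * b n = h ^ n * (b n * cis theta ^ n)).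
rewrite Cpow_mult_l; ring.
Qed.

Lemma rotation_analytic (f : C -> C) (theta : R) :
  analytic_on_disk f -> analytic_on_disk (rotation f theta).
Proof.
intros H z0 Hz0.
destruct (analytic_pseries_at f (cis theta * z0) H) as (b & r & Hr & Hb).
{ rewrite Cmod_mult, Cmod_cis; lra. }
exists (fun n => cis (- theta) * (b n * cis theta ^ n)), r; split; [exact Hr|]; intros z Hz.
replace (rotation f theta z) with (rotation f theta (z0 + (z - z0))) by (f_equal; ring).
apply rotation_pseries, Hb; rewrite Cmod_mult, Cmod_cis; lra.
Qed.

Lemma rotation_taylor_coeff (f : C -> C) (theta : R) (n : nat) :
  analytic_on_disk f ->
  taylor_coeff (rotation f theta) n = cis (- theta) * (taylor_coeff f n * cis theta ^ n).
Proof.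
intros H; destruct (analytic_taylor_series f H) as (r & Hr & Hs).
apply (taylor_coeff_pseries (fun n => cis (- theta) * (taylor_coeff f n * cis theta ^ n)) r); [exact Hr|].
intros z Hz; replace z with (0 + z) at 2 by ring.
apply rotation_pseries.
replace (cis theta * 0 + cis theta * z) with (cis theta * z) by ring.
apply Hs; rewrite Cmod_mult, Cmod_cis; lra.
Qed.

Lemma rotation_derive (f : C -> C) (theta : R) (z : C) :
  analytic_on_disk f -> (Cmod z < 1)%R ->
  C_derive (rotation f theta) z = C_derive f (cis theta * z).
Proof.
intros H Hz.
destruct (analytic_jet f (cis theta * z) H) as [D J].
{ rewrite Cmod_mult, Cmod_cis; lra. }
destruct (jet_first_order _ _ _ _ J) as (d & K & Hd & HK).
apply C_derive_of_quadratic_error; exists d, K; split; [exact Hd|]; intros h Hh Hl.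
assert (Hm : Cmod (cis theta * h) = Cmod h) by (rewrite Cmod_mult, Cmod_cis; ring).
assert (Hch : cis theta * h <> 0) by (apply Cmod_gt_0; rewrite Hm; now apply Cmod_gt_0).
specialize (HK _ Hch ltac:(now rewrite Hm)); cbv beta in HK; rewrite Hm in HK.
replace (rotation f theta (z + h) - rotation f theta z - C_derive f (cis theta * z) * h) with
  (cis (- theta) * (f (cis theta * z + cis theta * h) - f (cis theta * z) - C_derive f (cis theta * z) * (cis theta * h))).
- rewrite Cmod_mult, Cmod_cis, Rmult_1_l; exact HK.
- unfold rotation; replace (cis theta * (z + h)) with (cis theta * z + cis theta * h) by ring.
  transitivity (cis (- theta) * f (cis theta * z + cis theta * h) - cis (- theta) * f (cis theta * z)
     - C_derive f (cis theta * z) * (cis (- theta) * cis theta) * h); [ring|].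
  rewrite cis_mult_opp; ring.
Qed.

Lemma cis_neq_0 theta : cis theta <> 0.
Proof. apply Cmod_gt_0; rewrite Cmod_cis; lra. Qed.

Lemma rotation_class_U (f : C -> C) (theta : R) : class_U f -> class_U (rotation f theta).
Proof.
intros ((HA & H0 & H1) & Hnz & Hlt).
assert (Hm : forall z, Cmod (cis theta * z) = Cmod z) by (intros z; rewrite Cmod_mult, Cmod_cis; ring).
split; [split; [|split]|split].
- now apply rotation_analytic.
- rewrite rotation_taylor_coeff, H0 by exact HA; ring.
- rewrite rotation_taylor_coeff, H1 by exact HA.
  transitivity (cis (- theta) * cis theta); [simpl; ring|apply cis_mult_opp].
- intros z Hl Hz; apply Cmult_neq_0; [apply cis_neq_0|].
  apply Hnz; [now rewrite Hm|apply Cmult_neq_0; [apply cis_neq_0|exact Hz]].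
- intros z Hl; rewrite rotation_derive by assumption.
  replace (z_over (rotation f theta) z) with (z_over f (cis theta * z)).
  + apply Hlt; now rewrite Hm.
  + unfold z_over; destruct (Ceq_dec z 0) as [->|Hz].
    * destruct (Ceq_dec (cis theta * 0) 0) as [_|E]; [reflexivity|].
      exfalso; apply E; ring.
    * assert (Hcz : cis theta * z <> 0) by (apply Cmult_neq_0; [apply cis_neq_0|exact Hz]).
      destruct (Ceq_dec (cis theta * z) 0) as [E|_]; [contradiction|].
      assert (Hf := Hnz (cis theta * z) ltac:(now rewrite Hm) Hcz).
      unfold rotation.
      transitivity ((cis (- theta) * cis theta) * z / (cis (- theta) * f (cis theta * z))).
      { field; split; [exact Hf|apply cis_neq_0]. }
      rewrite cis_mult_opp, Cmult_1_l; reflexivity.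
Qed.

(** Since b(n) = u^(n-1) a(n) with |u| = 1, both functionals are homogeneous:
    they get multiplied by u^2 and u^4. *)
Lemma rotation_functionals (f : C -> C) (theta : R) (a := taylor_coeff f) (b := taylor_coeff (rotation f theta)) :
  class_U f ->
  Cmod (b 2%nat ^ 2 - b 3%nat) = Cmod (a 2%nat ^ 2 - a 3%nat) /\
  Cmod (b 3%nat ^ 2 - b 5%nat) = Cmod (a 3%nat ^ 2 - a 5%nat).
Proof.
intros ((HA & _) & _).
unfold b; rewrite !rotation_taylor_coeff by exact HA; fold a.
set (u := cis theta); set (v := cis (- theta)).
assert (E : v * u = 1) by apply cis_mult_opp.
assert (Hu : Cmod u = 1%R) by apply Cmod_cis.
split.
- replace ((v * (a 2%nat * u ^ 2)) ^ 2 - v * (a 3%nat * u ^ 3)) with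
   ((v * u) * u ^ 2 * ((v * u) * a 2%nat ^ 2 - a 3%nat)) by ring.
  rewrite E, !Cmult_1_l, Cmod_mult, Cmod_pow, Hu; ring.
- replace ((v * (a 3%nat * u ^ 3)) ^ 2 - v * (a 5%nat * u ^ 5)) with
   ((v * u) * u ^ 4 * ((v * u) * a 3%nat ^ 2 - a 5%nat)) by ring.
  rewrite E, !Cmult_1_l, Cmod_mult, Cmod_pow, Hu; ring.
Qed.

Lemma koebe_functionals :
  Cmod (taylor_coeff koebe 2 ^ 2 - taylor_coeff koebe 3) = 1%R /\
  Cmod (taylor_coeff koebe 3 ^ 2 - taylor_coeff koebe 5) = 4%R.
Proof.
rewrite !koebe_taylor_coeff, <- !RtoC_pow, <- !RtoC_minus, !Cmod_R; simpl.
split; rewrite Rabs_pos_eq; lra.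
Qed.

Theorem theorem1 :
  (forall f : C -> C, class_U f ->
     (Cmod (taylor_coeff f 2 ^ 2 - taylor_coeff f 3) <= 1)%R /\
     (Cmod (taylor_coeff f 3 ^ 2 - taylor_coeff f 5) <= 4)%R) /\
  (forall z : C, (Cmod z < 1)%R ->
     c_is_pseries (fun n : nat => RtoC (INR n)) z (koebe z)) /\
  (class_U koebe /\
   Cmod (taylor_coeff koebe 2 ^ 2 - taylor_coeff koebe 3) = 1%R /\
   Cmod (taylor_coeff koebe 3 ^ 2 - taylor_coeff koebe 5) = 4%R) /\
  (forall theta : R,
     class_U (rotation koebe theta) /\
     Cmod (taylor_coeff (rotation koebe theta) 2 ^ 2
           - taylor_coeff (rotation koebe theta) 3) = 1%R /\
     Cmod (taylor_coeff (rotation koebe theta) 3 ^ 2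
           - taylor_coeff (rotation koebe theta) 5) = 4%R).
Proof.
split; [exact class_U_coeff_bounds|].
split; [exact koebe_taylor_series|].
split; [split; [exact koebe_class_U|exact koebe_functionals]|].
intros theta; split; [apply rotation_class_U, koebe_class_U|].
destruct (rotation_functionals koebe theta koebe_class_U) as [-> ->].
exact koebe_functionals.
Qed.
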